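(* Let $\ell>0$, let $\kappa>0$ be a constant, let $\mathcal{H}$ be a bounded measurable function on $\mathbb{R}^3$, and let $C_{\mu\nu}$ ($\mu,\nu=0,\dots,3$) be a constant tensor. Let $T_{\mu\nu}\in\mathcal{S}^\prime(\mathbb{R}^3)$ be such that its Fourier transform is $$\tilde T_{\mu\nu}(\mathbf{k})=C_{\mu\nu}\,\mathcal{H}(\mathbf{k}).$$ Then $\frac{e^{-\ell^2|\mathbf{k}|^2}}{|\mathbf{k}|^2}\,\tilde T_{\mu\nu}$ belongs to $\mathcal{S}^\prime(\mathbb{R}^3)$, and consequently the solution $$\hat\Phi_{\mu\nu}=2\kappa\,\mathcal{F}^{-1}\left[\frac{e^{-\ell^2|\mathbf{k}|^2}}{|\mathbf{k}|^2}\,\tilde T_{\mu\nu}\right]$$ of the static field equation $\Delta\hat\Phi_{\mu\nu}=-2\kappa\,(\mathcal{E}_{(\ell)}\ast T_{\mu\nu})$ exists in $\mathcal{S}^\prime(\mathbb{R}^3)$.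
   Context: $\mathcal{S}^\prime(\mathbb{R}^3)$ is the space of tempered distributions; a locally integrable function $f$ with $\int_{\mathbb{R}^3}|f(\mathbf{k})|(1+|\mathbf{k}|^2)^{-s/2}\,d\mathbf{k}<\infty$ for some $s\ge0$ is identified with the tempered distribution $\varphi\mapsto\int f\varphi$. Fourier convention: $\tilde g(\mathbf{k})=\mathcal{F}[g](\mathbf{k})=\int_{\mathbb{R}^3}g(\mathbf{x})e^{-i\mathbf{k}\cdot\mathbf{x}}\,d\mathbf{x}$, with inverse carrying the factor $(2\pi)^{-3}$, extended to $\mathcal{S}^\prime(\mathbb{R}^3)$ by duality. $\mathcal{E}_{(\ell)}(\mathbf{x})=\frac{1}{(2\ell\sqrt{\pi})^3}e^{-|\mathbf{x}|^2/(4\ell^2)}$, $\Delta$ is the Laplacian on $\mathbb{R}^3$, and $\mathcal{E}_{(\ell)}\ast T_{\mu\nu}$ is the convolution of a Schwartz function with a tempered distribution. *)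

(* Defs.v *)
From HB Require Import structures.
From mathcomp Require Export all_boot all_order all_algebra.
From mathcomp Require Export all_classical all_reals all_analysis.
From mathcomp Require Export measurable_realfun.
Export Order.TTheory GRing.Theory Num.Theory.
Export numFieldNormedType.Exports.
From mathcomp Require Export complex.
Export ComplexField.Normc.
Set Implicit Arguments.
Unset Strict Implicit.
Unset Printing Implicit Defensive.
Local Open Scope classical_set_scope.
Local Open Scope ring_scope.
Local Open Scope complex_scope.

Notation R3 R := ((R * R * R)%type).

Definition coord (R : realType) (i : 'I_3) (x : R3 R) : R :=
  match val i with 0%N => x.1.1 | 1%N => x.1.2 | _ => x.2 end.

Definition basis (R : realType) (i : 'I_3) : R3 R :=
  ((val i == 0%N)%:R, (val i == 1%N)%:R, (val i == 2%N)%:R).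

Definition dot (R : realType) (x y : R3 R) : R :=
  \sum_(i < 3) coord i x * coord i y.

(* |x|^2 for the Euclidean norm; the norm `|x| of the product type R * R * R
   is the sup norm and is not used. *)
Definition sqnorm (R : realType) (x : R3 R) : R := dot x x.

(* [measurableTypeR R] is R with its Borel sigma-algebra, so [leb3] is a
   measure on the Borel sets of R^3. *)
Definition leb3 (R : realType) :
    {measure set (R3 (measurableTypeR R))%type -> \bar R} :=
  ((@lebesgue_measure R \x @lebesgue_measure R) \x @lebesgue_measure R)%E.

(* Measurability for the completed (Lebesgue) sigma-algebra: the preimage of a
   Borel set is a Borel set up to a subset of a null set.  The library integral
   of such a function against [leb3] is its usual Lebesgue integral. *)
Definition lebesgue_measurable (R : realType) (f : R3 R -> R[i]) : Prop :=
  forall B : set R, measurable B ->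
    completed_algebra_gen (leb3 R) ((fun x => Re (f x)) @^-1` B) /\
    completed_algebra_gen (leb3 R) ((fun x => Im (f x)) @^-1` B).

Definition cintegral (R : realType) (f : R3 R -> R[i]) : R[i] :=
  (\int[leb3 R]_x Re (f x)) +i* (\int[leb3 R]_x Im (f x)).

Definition cexpi (R : realType) (t : R) : R[i] := cos t +i* sin t.

Definition partial (R : realType) (i : 'I_3) (f : R3 R -> R[i]) :
    R3 R -> R[i] :=
  fun x => ('D_(basis R i) (fun y => Re (f y)) x)
           +i* ('D_(basis R i) (fun y => Im (f y)) x).

(* Iterated partial derivatives are indexed by sequences of directions; on
   smooth functions their order is irrelevant, so that these are the usual
   derivatives indexed by multi-indices. *)
Definition partials (R : realType) (s : seq 'I_3) (f : R3 R -> R[i]) :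
    R3 R -> R[i] :=
  foldr (@partial R) f s.

Definition smooth (R : realType) (f : R3 R -> R[i]) : Prop :=
  forall s : seq 'I_3,
    [/\ continuous (fun x => Re (partials s f x) : R),
        continuous (fun x => Im (partials s f x) : R) &
        forall (i : 'I_3) (x : R3 R),
          derivable (fun y => Re (partials s f y) : R) x (basis R i) /\
          derivable (fun y => Im (partials s f y) : R) x (basis R i)].

Definition monomial (R : realType) (a : 'I_3 -> nat) (x : R3 R) : R :=
  \prod_(i < 3) coord i x ^+ a i.

Definition schwartz (R : realType) (f : R3 R -> R[i]) : Prop :=
  smooth f /\
  forall (a : 'I_3 -> nat) (s : seq 'I_3), exists M : R,
    forall x, normc ((monomial a x)%:C * partials s f x) <= M.

(* Basic neighbourhoods of 0 in the Schwartz space: the functions whose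
   seminorms sup_x |x^a D^s f(x)| of order at most N are at most d. *)
Definition schwartz_ball (R : realType) (N : nat) (d : R) (f : R3 R -> R[i]) :
    Prop :=
  forall (a : 'I_3 -> nat) (s : seq 'I_3),
    (\sum_(i < 3) a i <= N)%N -> (size s <= N)%N ->
    forall x, normc ((monomial a x)%:C * partials s f x) <= d.

(* Distributions are represented by functionals on all functions R^3 -> C, of
   which only the values on Schwartz functions are meaningful: the predicate
   [tempered] and the equality [dist_eq] do not see the other values. *)
Definition functional (R : realType) : Type := (R3 R -> R[i]) -> R[i].

Definition dist_eq (R : realType) (T U : functional R) : Prop :=
  forall phi, schwartz phi -> T phi = U phi.

Definition schwartz_linear (R : realType) (T : functional R) : Prop :=
  forall (c : R[i]) phi psi, schwartz phi -> schwartz psi ->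
    T (fun x => c * phi x + psi x) = c * T phi + T psi.

Definition schwartz_continuous (R : realType) (T : functional R) : Prop :=
  forall phi0, schwartz phi0 -> forall eps : R, 0 < eps ->
  exists N : nat, exists2 d : R, 0 < d &
  forall phi, schwartz phi -> schwartz_ball N d (fun x => phi x - phi0 x) ->
    normc (T phi - T phi0) < eps.

Definition tempered (R : realType) (T : functional R) : Prop :=
  schwartz_linear T /\ schwartz_continuous T.

Definition locally_integrable3 (R : realType) (f : R3 R -> R[i]) : Prop :=
  lebesgue_measurable f /\
  forall K : set (R3 R), compact K ->
    (\int[leb3 R]_(x in K) (normc (f x))%:E < +oo)%E.

Definition tempered_function (R : realType) (f : R3 R -> R[i]) : Prop :=
  locally_integrable3 f /\
  exists2 s : R, 0 <= s &
    (\int[leb3 R]_k (normc (f k) * (1 + sqnorm k) `^ (- (s / 2)))%:E < +oo)%E.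

Definition dist_of_fun (R : realType) (f : R3 R -> R[i]) : functional R :=
  fun phi => cintegral (fun x => f x * phi x).

Definition dist_scale (R : realType) (c : R) (T : functional R) :
    functional R :=
  fun phi => c%:C * T phi.

Definition fourier (R : realType) (g : R3 R -> R[i]) : R3 R -> R[i] :=
  fun k => cintegral (fun x => g x * cexpi (- dot k x)).

Definition inv_fourier (R : realType) (g : R3 R -> R[i]) : R3 R -> R[i] :=
  fun x => (((2 * pi) ^+ 3)^-1)%:C * cintegral (fun k => g k * cexpi (dot k x)).

Definition dist_fourier (R : realType) (T : functional R) : functional R :=
  fun phi => T (fourier phi).

Definition dist_inv_fourier (R : realType) (T : functional R) : functional R :=
  fun phi => T (inv_fourier phi).

Definition laplacian (R : realType) (f : R3 R -> R[i]) : R3 R -> R[i] :=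
  fun x => \sum_(i < 3) partial i (partial i f) x.

Definition dist_laplacian (R : realType) (T : functional R) : functional R :=
  fun phi => T (laplacian phi).

Definition conv (R : realType) (f g : R3 R -> R[i]) : R3 R -> R[i] :=
  fun x => cintegral (fun y => f (x - y) * g y).

(* <f * T, phi> = <T, f~ * phi> where f~(x) = f(-x). *)
Definition dist_conv (R : realType) (f : R3 R -> R[i]) (T : functional R) :
    functional R :=
  fun phi => T (conv (fun x => f (- x)) phi).

Definition gaussian (R : realType) (l : R) : R3 R -> R[i] :=
  fun x => (((2 * l * Num.sqrt pi) ^+ 3)^-1
            * expR (- (sqnorm x / (4 * l ^+ 2))))%:C.

(* Main.v *)
(* The weight [exp(- l^2 |k|^2) / |k|^2] is integrable on R^3, being the integral
   over [t >= l^2] of the Gaussians [exp(- t |k|^2)].  Hence its product with a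
   bounded function defines a tempered distribution, also after composition with
   the inverse Fourier transform, which is bounded on Schwartz functions.

   For the field equation, [- |k|^2 F^-1 phi = F^-1 (Laplacian phi)] by
   integration by parts, so the left side tested against [phi] is
   [- 2 kappa \int C H psi] with [psi = exp(- l^2 |k|^2) F^-1 phi].  This [psi] is
   Schwartz, and Fubini with the Fourier transform of the Gaussian gives
   [F psi = E_l * phi] without Fourier inversion, so the hypothesis on the Fourier
   transform of [T] identifies the two sides.

   Fourier integrals are handled through the real integrals
   [\int h(x) cos(k.x + c) dx]: differentiation in [k] or integration by parts in
   [x] only shifts the phase [c] by [pi / 2].  The Lebesgue measurable [H] is
   replaced by a Borel function equal to it off a null set. *)

(* All that is known of [T] is its value on Fourier transforms of Schwartz functions, so [E_l * phi]
   has to be exhibited as such a transform. The Gaussian makes this possible at low cost: it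
   supplies all the decay of [psi], while the Fourier integrals multiplying it, and their
   derivatives, enter only through boundedness and continuity. Most estimates are therefore made for
   the class [rapid], which records decay and measurability without smoothness. Its members are
   dominated by a product of three functions [1 / (1 + t^2)], and this reduces integrability, Fubini
   on slices and the vanishing of boundary terms to dimension one. Both temperedness claims are one
   estimate, an integrable weight against the supremum of [phi] or of [F^-1 phi]. The second
   supremum is controlled by seminorms of order 6, two powers for each coordinate. Since division by
   zero returns [0], the cancellation of [|k|^2] fails at the origin. It is used off that single
   point, which is a null set. *)
Require Import Defs.
From HB Require Import structures.
From mathcomp Require Import ring lra.
Set Implicit Arguments.
Unset Strict Implicit.
Unset Printing Implicit Defensive.
Local Open Scope classical_set_scope.
Local Open Scope ring_scope.
Local Open Scope complex_scope.

(** * Borel functions on R^3 *)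

Section Measurability.
Context {R : realType}.
Implicit Types (x y : R3 R) (i : 'I_3).

Lemma measurable_coord i : measurable_fun setT (coord i : R3 R -> R).
Proof.
rewrite /coord; case: i => -[|[|i]] /= _.
- exact: (measurableT_comp measurable_fst measurable_fst).
- exact: (measurableT_comp measurable_snd measurable_fst).
- exact: measurable_snd.
Qed.

Lemma ball_rat (x : R) (e : R) : 0 < e -> exists q : rat, ball (ratr q : R) e x.
Proof.
move=> e0; have /rat_in_itvoo[q] : x - e < x + e by lra.
rewrite in_itv/= => /andP[h1 h2]; exists q.
by rewrite /ball/= /ball_ ltr_norml; apply/andP; split; lra.
Qed.

(** The measurable sets of [R3 R] are generated by boxes, so an open set is written as the union of
    the countably many boxes with rational centre and radius [1 / (n + 1)] that it contains. *)
Lemma open_measurable3 (U : set (R3 R)) : open U -> measurable U.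
Proof.
move=> oU.
pose B (p : rat * rat * rat * nat) : set (R3 R) :=
  (ball (ratr p.1.1.1 : R) (p.2.+1%:R^-1) `*` ball (ratr p.1.1.2 : R) (p.2.+1%:R^-1))
  `*` ball (ratr p.1.2 : R) (p.2.+1%:R^-1).
have mB p : measurable (B p).
  by apply: measurableX; [apply: measurableX|]; exact: measurable_ball.
have -> : U = \bigcup_p (if `[< B p `<=` U >] then B p else set0).
  apply/seteqP; split => [x Ux|x [p _]]; last first.
    by case: ifPn => // /asboolP; exact.
  have : nbhs x U by exact: open_nbhs_nbhs.
  move=> /nbhs_ballP[e /= e0 xeU].
  (* The box contains [x] without being centred there; two of its points may differ by twice the
     radius in each coordinate, hence [e / 2]. *)
  have [n en] : exists n, n.+1%:R^-1 < e / 2.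
    have /ltr_add_invr[n] : 0 < e / 2 by rewrite divr_gt0.
    by rewrite add0r; exists n.
  have n0 : 0 < n.+1%:R^-1 :> R by rewrite invr_gt0.
  have [q1 h1] := ball_rat x.1.1 n0.
  have [q2 h2] := ball_rat x.1.2 n0.
  have [q3 h3] := ball_rat x.2 n0.
  exists (q1, q2, q3, n) => //; rewrite ifT; first by [].
  apply/asboolP => y [[/= b1 b2] b3]; apply: xeU.
  have ht (a b c : R) : ball b n.+1%:R^-1 a -> ball b n.+1%:R^-1 c -> ball a e c.
    move=> /ball_sym h h'; have := ball_triangle h h'.
    by apply: le_ball; rewrite (splitr e) lerD// ltW.
  split; [split|]; rewrite /=.
  - exact: ht h1 b1.
  - exact: ht h2 b2.
  - exact: ht h3 b3.
apply: countable_bigcupT_measurable => [|p]; first exact: countableP.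
by case: ifPn.
Qed.

Lemma continuous_measurable3 (f : R3 R -> R) :
  continuous f -> measurable_fun setT f.
Proof.
move=> /continuousP cf; apply: (measurability _ (RGenOpens.measurableE R)).
move=> _ [_ [a [b ->] <-]]; rewrite setTI; apply: open_measurable3.
exact/cf/interval_open.
Qed.

Lemma continuous_coord i : continuous (coord i : R3 R -> R).
Proof.
move=> x; rewrite /coord; case: i => -[|[|i]] /= _.
- by apply: (@continuous_comp _ _ _ fst fst); exact: cvg_fst || exact: cvg_snd.
- by apply: (@continuous_comp _ _ _ fst snd); exact: cvg_fst || exact: cvg_snd.
- exact: cvg_snd.
Qed.

End Measurability.

(** * Integrability by domination, and on product spaces *)

Section Integration.
Context d {T : measurableType d} {R : realType}.

Lemma integrable_bounded (mu : {measure set T -> \bar R}) (f g : T -> R) :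
  measurable_fun setT f -> (forall x, `|f x| <= g x) ->
  mu.-integrable setT (EFin \o g) -> mu.-integrable setT (EFin \o f).
Proof.
move=> mf fg; apply: le_integrable => //; first exact/measurable_EFinP.
move=> x _; rewrite /= lee_fin; apply: (le_trans (fg x)).
exact: ler_norm.
Qed.

Lemma integrable_Mbounded (mu : {measure set T -> \bar R}) (f g : T -> R) M :
  measurable_fun setT f -> (forall x, `|f x| <= M) ->
  mu.-integrable setT (EFin \o g) -> mu.-integrable setT (EFin \o (f \* g)).
Proof.
move=> mf fM ig.
have /integrableP[/measurable_EFinP mg _] := ig.
have M0 : 0 <= M.
  by apply: le_trans (fM point).
apply: (@integrable_bounded _ _ (fun x => M * `|g x|)).
- exact: measurable_funM.
- by move=> x /=; rewrite normrM ler_wpM2r.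
- have -> : EFin \o (fun x => M * `|g x|) = (fun x => M%:E * (abse \o (EFin \o g)) x)%E.
    by apply/funext => x.
  by apply: integrableZl => //; exact: integrable_abse.
Qed.

Lemma integrableM_bounded (mu : {measure set T -> \bar R}) (f g : T -> R) M :
  measurable_fun setT g -> (forall x, `|g x| <= M) ->
  mu.-integrable setT (EFin \o f) -> mu.-integrable setT (EFin \o (f \* g)).
Proof.
move=> mg gM jf; have := @integrable_Mbounded mu g f M mg gM jf.
by congr (_.-integrable _ _); apply/funext => x /=; rewrite mulrC.
Qed.

End Integration.

Lemma integrable_tensor d1 d2 (T1 : measurableType d1) (T2 : measurableType d2)
    (R : realType) (m1 : {sigma_finite_measure set T1 -> \bar R})
    (m2 : {sigma_finite_measure set T2 -> \bar R}) (f : T1 -> R) (g : T2 -> R) :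
  m1.-integrable setT (EFin \o f) -> m2.-integrable setT (EFin \o g) ->
  (m1 \x m2)%E.-integrable setT (fun z => (f z.1 * g z.2)%:E).
Proof.
move=> jf jg; have /integrableP[/measurable_EFinP mf lf] := jf.
have /integrableP[/measurable_EFinP mg lg] := jg.
have mfg : measurable_fun setT (fun z : T1 * T2 => f z.1 * g z.2).
  apply: measurable_funM.
    exact: (measurableT_comp mf measurable_fst).
  exact: (measurableT_comp mg measurable_snd).
apply/integrable12ltyP; first exact/measurable_EFinP.
set c := (\int[m2]_y (`|g y|)%:E)%E.
have c0 : (0 <= c)%E by apply: integral_ge0 => y _; rewrite lee_fin.
have cE : c = (fine c)%:E by rewrite fineK// ge0_fin_numE.
rewrite (eq_integral (fun x => (fine c)%:E * (`|f x|)%:E)%E) => [|x _].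
  rewrite ge0_integralZl_EFin ?fine_ge0//.
    by rewrite lte_mul_pinfty// ?lee_fin ?fine_ge0.
  exact/measurable_EFinP/measurableT_comp.
rewrite -cE muleC /c -ge0_integralZl_EFin//; last first.
  exact/measurable_EFinP/measurableT_comp.
by apply: eq_integral => y _ /=; rewrite normrM EFinM.
Qed.

Lemma ord3_ind (P : 'I_3 -> Prop) :
  P ord0 -> P (lift ord0 ord0) -> P (lift ord0 (lift ord0 ord0)) ->
  forall i, P i.
Proof.
move=> h0 h1 h2 [[|[|[|//]]] hi].
- by rewrite (_ : Ordinal hi = ord0) //; exact: val_inj.
- by rewrite (_ : Ordinal hi = lift ord0 ord0) //; exact: val_inj.
- by rewrite (_ : Ordinal hi = lift ord0 (lift ord0 ord0)) //; exact: val_inj.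
Qed.

(* The library's sigma-finite structure on a product measure is not found by
   unification, which tries its subprobability instance first. *)
Lemma sigma_finite_product d1 d2 (T1 : measurableType d1)
    (T2 : measurableType d2) (R : realType)
    (m1 : {sigma_finite_measure set T1 -> \bar R})
    (m2 : {sigma_finite_measure set T2 -> \bar R}) :
  sigma_finite setT (m1 \x m2)%E.
Proof.
have /sigma_finiteP[A [TA ndA fA]] := sigma_finiteT m1.
have /sigma_finiteP[B [TB ndB fB]] := sigma_finiteT m2.
exists (fun n => A n `*` B n); last first.
  move=> n; have [mA Aoo] := fA n; have [mB Boo] := fB n.
  by split; [exact: measurableX|rewrite product_measure1E// lte_mul_pinfty//
    ge0_fin_numE].
apply/seteqP; split => // -[x y] _.
have [n _ nx] : (\bigcup_n A n) x by rewrite -TA.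
have [m _ my] : (\bigcup_n B n) y by rewrite -TB.
exists (maxn n m) => //; split => /=.
- by have /subsetPset := ndA _ _ (leq_maxl n m); exact.
- by have /subsetPset := ndB _ _ (leq_maxr n m); exact.
Qed.

Section LebesgueProducts.
Context {R : realType}.

Definition leb2 : set (measurableTypeR R * measurableTypeR R)%type -> \bar R :=
  (@lebesgue_measure R \x @lebesgue_measure R)%E.
HB.instance Definition _ := Measure.on leb2.
HB.instance Definition _ := Measure_isSigmaFinite.Build _ _ _ leb2
  (@sigma_finite_product _ _ _ _ R (@lebesgue_measure R) (@lebesgue_measure R)).

(* [leb3 R] with the sigma-finiteness that its type does not record. *)
Definition leb3_sf : set (R3 (measurableTypeR R))%type -> \bar R :=
  (leb2 \x @lebesgue_measure R)%E.
HB.instance Definition _ := Measure.on leb3_sf.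
HB.instance Definition _ := Measure_isSigmaFinite.Build _ _ _ leb3_sf
  (@sigma_finite_product _ _ _ _ R leb2 (@lebesgue_measure R)).

End LebesgueProducts.

(** * Rapidly decreasing functions and their integrable majorant *)

Section Decay.
Context {R : realType}.
Implicit Types (x : R3 R) (h : R3 R -> R).

Lemma monomialE (a : 'I_3 -> nat) x : monomial a x =
  x.1.1 ^+ a ord0 * x.1.2 ^+ a (lift ord0 ord0)
  * x.2 ^+ a (lift ord0 (lift ord0 ord0)).
Proof. by rewrite /monomial !big_ord_recl big_ord0 /coord /= mulr1 mulrA. Qed.

Lemma dotE (x y : R3 R) :
  dot x y = x.1.1 * y.1.1 + x.1.2 * y.1.2 + x.2 * y.2.
Proof. by rewrite /dot !big_ord_recl big_ord0 /coord /= addr0 addrA. Qed.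

Lemma sqnormE x : sqnorm x = x.1.1 ^+ 2 + x.1.2 ^+ 2 + x.2 ^+ 2.
Proof. by rewrite /sqnorm dotE !expr2. Qed.

Lemma monomialD (a b : 'I_3 -> nat) x :
  monomial (fun i => (a i + b i)%N) x = monomial a x * monomial b x.
Proof. by rewrite !monomialE !exprD; ring. Qed.

Lemma monomial_delta i x : monomial (fun j => (j == i) : nat) x = coord i x.
Proof.
by rewrite monomialE; elim/ord3_ind: i; rewrite /coord /= ?expr0 ?expr1; ring.
Qed.

Lemma monomial0 x : monomial (fun=> 0%N) x = 1.
Proof. by rewrite monomialE !expr0 !mulr1. Qed.

(** An integrable majorant of product form, chosen so that Fubini and restrictions to coordinate
    lines act on one factor at a time. *)
Definition decay x : R :=
  (oneDsqr x.1.1)^-1 * (oneDsqr x.1.2)^-1 * (oneDsqr x.2)^-1.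

Lemma oneDsqr_gt0 (t : R) : 0 < oneDsqr t.
Proof. exact: lt_le_trans (oneDsqr_ge1 t). Qed.

Lemma oneDsqrV_gt0 (t : R) : 0 < (oneDsqr t)^-1.
Proof. by rewrite invr_gt0 oneDsqr_gt0. Qed.

Lemma decay_gt0 x : 0 < decay x.
Proof. by rewrite !mulr_gt0 ?oneDsqrV_gt0. Qed.

(** The product of the three factors [1 + t^2] expands into 8 monomials whose exponents are all 0 or
    2; each contributes at most [d]. *)
Lemma decay_bound x (r d : R) :
  (forall a, (forall i, (a i <= 2)%N) -> `|monomial a x * r| <= d) ->
  `|r| <= 8 * d * decay x.
Proof.
move=> H.
have H' a b c : (a <= 2)%N -> (b <= 2)%N -> (c <= 2)%N ->
    `|x.1.1 ^+ a * x.1.2 ^+ b * x.2 ^+ c * r| <= d.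
  move=> ha hb hc; have := H (fun i : 'I_3 => nth 0%N [:: a; b; c] i).
  by rewrite monomialE /=; apply; elim/ord3_ind.
have le2 (a : 'I_2) : (2 * a <= 2)%N by case: a => -[|[|]].
rewrite /decay -!invfM ler_pdivlMr ?mulr_gt0 ?oneDsqr_gt0//.
rewrite -[X in _ * X <= _]gtr0_norm ?mulr_gt0 ?oneDsqr_gt0// -normrM.
have -> : r * (oneDsqr x.1.1 * oneDsqr x.1.2 * oneDsqr x.2) =
  \sum_(a < 2) \sum_(b < 2) \sum_(c < 2)
    x.1.1 ^+ (2 * a) * x.1.2 ^+ (2 * b) * x.2 ^+ (2 * c) * r.
  by rewrite !big_ord_recl !big_ord0 /= /oneDsqr; ring.
apply: le_trans (ler_norm_sum _ _ _) _.
have -> : 8 * d = \sum_(a < 2) \sum_(b < 2) \sum_(c < 2) d.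
  by rewrite !sumr_const !card_ord; ring.
apply: ler_sum => a _; apply: le_trans (ler_norm_sum _ _ _) _.
apply: ler_sum => b _; apply: le_trans (ler_norm_sum _ _ _) _.
by apply: ler_sum => c _; apply: H'; exact: le2.
Qed.

Lemma integrable_oneDsqrV :
  (@lebesgue_measure R).-integrable setT (EFin \o (fun t => (oneDsqr t)^-1)).
Proof.
have c : continuous (fun t : R => (oneDsqr t)^-1) by exact: continuous_oneDsqrV.
apply/integrableP; split.
  by apply/measurable_EFinP; apply: continuous_measurable_fun; exact: c.
under eq_integral => t _ do rewrite /= ger0_norm ?ltW ?oneDsqrV_gt0//.
rewrite ge0_symfun_integralT//.
- rewrite (_ : [set x | _] = `[0, +oo[%classic); last first.
    by apply/seteqP; split => x/=; rewrite in_itv/= andbT.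
  by rewrite integral0y_oneDsqr -EFinM ltry.
- by move=> t /=; rewrite /oneDsqr sqrrN.
Qed.

Lemma integrable_decay : (leb3 R).-integrable setT (EFin \o decay).
Proof.
have h1 := integrable_oneDsqrV.
exact: (@integrable_tensor _ _ _ _ R leb2 (@lebesgue_measure R)
  (fun z => (oneDsqr z.1)^-1 * (oneDsqr z.2)^-1) _ (integrable_tensor h1 h1) h1).
Qed.

(** The decay half of the Schwartz condition. Unlike smoothness, it survives multiplication by any
    bounded measurable function, in particular by the cosines of a Fourier integral. *)
Definition rapid h := measurable_fun setT h /\
  forall a, exists M : R, forall x, `|monomial a x * h x| <= M.

Lemma rapid_coord i h : rapid h -> rapid (fun x => coord i x * h x).
Proof.
move=> [mh bh]; split.
  by apply: measurable_funM => //; exact: measurable_coord.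
move=> a; have [M hM] := bh (fun j => (a j + (j == i))%N).
by exists M => x; have := hM x; rewrite monomialD monomial_delta mulrA.
Qed.

Lemma rapidD h1 h2 : rapid h1 -> rapid h2 -> rapid (fun x => h1 x + h2 x).
Proof.
move=> [m1 b1] [m2 b2]; split; first exact: measurable_funD.
move=> a; have [M1 h1M] := b1 a; have [M2 h2M] := b2 a.
by exists (M1 + M2) => x; rewrite mulrDr (le_trans (ler_normD _ _)) ?lerD.
Qed.

Lemma rapidM_bounded h (f : R3 R -> R) K : rapid h -> measurable_fun setT f ->
  (forall x, `|f x| <= K) -> rapid (fun x => h x * f x).
Proof.
move=> [mh bh] mf fK; split; first exact: measurable_funM.
move=> a; have [M hM] := bh a; exists (M * K) => x.
by rewrite mulrA normrM ler_pM.
Qed.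

Lemma rapidZ c h : rapid h -> rapid (fun x => c * h x).
Proof.
move=> rh; have := @rapidM_bounded h (fun=> c) `|c| rh.
rewrite (_ : (fun x => h x * c) = (fun x => c * h x)); first by apply.
by apply/funext => x; rewrite mulrC.
Qed.

Lemma rapidN h : rapid h -> rapid (fun x => - h x).
Proof.
by move=> /(rapidZ (-1)); congr rapid; apply/funext => x; rewrite mulN1r.
Qed.

Lemma rapid_decay h : rapid h -> exists2 M : R, 0 <= M & forall x, `|h x| <= M * decay x.
Proof.
move=> [_ bh].
pose mk a b c := fun i : 'I_3 => nth 0%N [:: a; b; c] i.
have /choice[M hM] : forall t : 'I_3 * 'I_3 * 'I_3, exists M : R, forall x,
    `|monomial (mk t.1.1 t.1.2 t.2) x * h x| <= M by move=> t; exact: bh.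
(* Only the 27 monomials with exponents at most 2 matter for [decay_bound], so the sum of their
   bounds is one constant valid for all of them. *)
pose K := \sum_t `|M t|.
have K0 : 0 <= K by exact: sumr_ge0.
exists (8 * K) => [|x]; first by rewrite mulr_ge0.
apply: decay_bound => a ha.
pose t : 'I_3 * 'I_3 * 'I_3 := (inord (a ord0), inord (a (lift ord0 ord0)),
  inord (a (lift ord0 (lift ord0 ord0)))).
have -> : monomial a x = monomial (mk t.1.1 t.1.2 t.2) x.
  by rewrite !monomialE /mk/= !inordK ?ltnS ?ha.
apply: le_trans (hM t x) _; apply: le_trans (ler_norm _) _.
by rewrite /K (bigD1 t)//= lerDl sumr_ge0.
Qed.

Lemma integrable_le_decay h (M : R) : measurable_fun setT h ->
  (forall x, `|h x| <= M * decay x) -> (leb3 R).-integrable setT (EFin \o h).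
Proof.
move=> mh hM; apply: (@integrable_bounded _ _ R (leb3 R) h _ mh hM).
have := integrableZl measurableT M integrable_decay.
by congr (_.-integrable _ _); apply/funext => x.
Qed.

Lemma rapid_integrable h : rapid h -> (leb3 R).-integrable setT (EFin \o h).
Proof.
move=> rh; have [M _ hM] := rapid_decay rh.
by apply: integrable_le_decay hM; exact: rh.1.
Qed.

Lemma rapid_bound h : rapid h -> exists M : R, forall x, `|h x| <= M.
Proof.
move=> [_ /(_ (fun=> 0%N))[M hM]]; exists M => x.
by have := hM x; rewrite monomial0 mul1r.
Qed.

End Decay.

(** Both sides have the same difference quotients. This moves directional derivatives on R^3 to
    one-variable calculus and back. *)
Lemma is_derive_line (R : realType) (V : normedModType R) (f : V -> R)
    (x v : V) (t d : R) :
  is_derive (x + t *: v) v f d <-> is_derive t 1 (fun s => f (x + s *: v)) d.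
Proof.
have E : (fun h => h^-1 *: ((f \o shift (x + t *: v)) (h *: v) - f (x + t *: v)))
  = (fun h => h^-1 *: (((fun s => f (x + s *: v)) \o shift t) (h *: (1 : R)) -
                       f (x + t *: v))).
  apply/funext => h /=.
  by rewrite scalerDl scaler1 addrCA.
by split=> -[D1 D2]; split; move: D1 D2; rewrite /derivable /derive E.
Qed.

(** * Fourier integrals with a phase *)

Section TrigTransform.
Context {R : realType}.
Implicit Types (k v x y : R3 R) (h : R3 R -> R) (c : R).

Lemma coordD i x y : coord i (x + y) = coord i x + coord i y.
Proof. by elim/ord3_ind: i. Qed.

Lemma coordZ i (t : R) x : coord i (t *: x) = t * coord i x.
Proof. by elim/ord3_ind: i. Qed.

Lemma coord_basis i j : coord i (basis R j) = (i == j)%:R.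
Proof. by elim/ord3_ind: i; elim/ord3_ind: j. Qed.

Lemma dotC x y : dot x y = dot y x.
Proof. by apply: eq_bigr => i _; rewrite mulrC. Qed.

Lemma dotDl x y z : dot (x + y) z = dot x z + dot y z.
Proof. by rewrite -big_split; apply: eq_bigr => i _; rewrite coordD mulrDl. Qed.

Lemma dotZl (t : R) x y : dot (t *: x) y = t * dot x y.
Proof. by rewrite /dot mulr_sumr; apply: eq_bigr => i _; rewrite coordZ mulrA. Qed.

Lemma dotNl x y : dot (- x) y = - dot x y.
Proof. by rewrite -scaleN1r dotZl mulN1r. Qed.

Lemma dot_basis i x : dot (basis R i) x = coord i x.
Proof.
rewrite /dot (bigD1 i)//= coord_basis eqxx mul1r big1 ?addr0// => j ji.
by rewrite coord_basis (negbTE ji) mul0r.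
Qed.

Lemma measurable_dot k : measurable_fun setT (dot k : R3 R -> R).
Proof.
rewrite (_ : dot k = (fun x => k.1.1 * x.1.1 + k.1.2 * x.1.2 + k.2 * x.2)); last first.
  by apply/funext => x; rewrite dotE.
apply: measurable_funD; [apply: measurable_funD|]; apply: measurable_funM => //.
- exact: (@measurable_coord R ord0).
- exact: (@measurable_coord R (lift ord0 ord0)).
Qed.

Lemma measurable_cos_phase k c : measurable_fun setT (fun x : R3 R => cos (dot k x + c)).
Proof.
apply: (measurableT_comp (f := cos)).
  by apply: continuous_measurable_fun; exact: continuous_cos.
by apply: measurable_funD => //; exact: measurable_dot.
Qed.

Lemma norm_cos_le1 (t : R) : `|cos t| <= 1.
Proof. by rewrite ler_norml cos_geN1 cos_le1. Qed.

Lemma rapid_dot v h : rapid h -> rapid (fun x => dot v x * h x).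
Proof.
move=> rh.
have r i := rapidZ (coord i v) (rapid_coord i rh).
have := rapidD (rapidD (r ord0) (r (lift ord0 ord0))) (r (lift ord0 (lift ord0 ord0))).
by congr rapid; apply/funext => x; rewrite dotE /coord /=; ring.
Qed.

Lemma rapid_cos h k c : rapid h -> rapid (fun x => h x * cos (dot k x + c)).
Proof.
move=> rh; apply: (rapidM_bounded rh (measurable_cos_phase k c)) => x.
exact: norm_cos_le1.
Qed.

(** Phase [0] is the cosine transform and phase [- (pi / 2)] the sine transform, so one family
    covers the real and imaginary parts of Fourier integrals. *)
Definition trig_transform h c k : R :=
  \int[leb3 R]_x (h x * cos (dot k x + c)).

Lemma trig_transform_bound h : rapid h -> exists M : R, forall c k,
  `|trig_transform h c k| <= M.
Proof.
move=> rh; exists (\int[leb3 R]_x `|h x|) => c k.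
have ih := rapid_integrable rh.
have ihc := rapid_integrable (rapid_cos k c rh).
apply: le_trans (le_normr_Rintegral _ ihc) _ => //.
apply: le_Rintegral => //.
- exact: (integrable_abse ihc).
- exact: (integrable_abse ih).
- by move=> x _; rewrite normrM ler_piMr ?norm_cos_le1.
Qed.

(** Differentiation under the integral sign: the derivative of the integrand is dominated by the
    absolute value of [dot v x * h x], which is integrable because [rapid] is stable under linear
    factors. *)
Lemma is_derive_trig_transform h c k v : rapid h ->
  is_derive k v (trig_transform h c)
    (trig_transform (fun x => dot v x * h x) (c + pi / 2) k).
Proof.
move=> rh.
pose f (t : R) x := h x * cos (dot (k + t *: v) x + c).
have df (t : R) x : is_derive t (1 : R) (f ^~ x)
    (dot v x * h x * cos (dot (k + t *: v) x + (c + pi / 2))).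
  rewrite addrA cosDpihalf.
  have -> : f ^~ x = h x *: (cos \o (fun t : R => t * dot v x + (dot k x + c))).
    apply/funext => s; rewrite /f /= dotDl dotZl fctE/=.
    by congr (_ * cos _); ring.
  have -> : dot (k + t *: v) x + c = t * dot v x + (dot k x + c).
    by rewrite dotDl dotZl; ring.
  have D : is_derive t (1 : R) (fun t : R => t * dot v x + (dot k x + c)) (dot v x).
    by apply: is_derive_eq; rewrite /= ?scaler0 ?scaler1 ?addr0 ?add0r -?[_ *: _]/(_
      * _) ?mulr1 ?mul1r.
  have D' := @is_derive1_comp R cos
    (fun t => t * dot v x + (dot k x + c)) t _ _ (is_derive_cos _) D.
  apply: is_derive_eq (is_deriveZ (h x) D') _.
  by rewrite -[LHS]/(_ * _); ring.
have fE t : f t = fun x => h x * cos (dot (k + t *: v) x + c) by [].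
have rd := rapid_dot v rh.
have int_f t : (leb3 R).-integrable setT (EFin \o f t).
  exact: rapid_integrable (rapid_cos (k + t *: v) c rh).
have d1 t x : partial1of2 f t x = dot v x * h x * cos (dot (k + t *: v) x + (c + pi / 2)).
  by rewrite partial1of2E; have [] := df t x.
pose G x := `|dot v x * h x|.
have iG : (leb3 R).-integrable setT (EFin \o G).
  exact: (integrable_abse (rapid_integrable rd)).
(* The bound [G] is uniform in [t]; any open interval around [0] serves. *)
have I0 : `](-1), 1[%classic (0 : R) by rewrite /= in_itv/= ltrN10 ltr01.
have dG t x : `](-1), 1[%classic (t : R) -> setT x -> `|partial1of2 f t x| <= G x.
  by move=> _ _; rewrite d1 normrM ler_piMr ?norm_cos_le1.
have derf (t : R) x : `](-1), 1[%classic (t : R) -> setT x -> derivable (f ^~ x) t (1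
  : R).
  by move=> _ _; have [] := df t x.
have G0 x : 0 <= G x by exact: normr_ge0.
have D1 := @derivable_under_integral R _ _ (leb3 R) f setT measurableT 0 (-1) 1
  I0 (fun t _ => int_f t) derf G G0 iG dG.
have D2 := @differentiation_under_integral R _ _ (leb3 R) f setT measurableT 0 (-1) 1
  I0 (fun t _ => int_f t) derf G G0 iG dG.
rewrite -[X in is_derive X _ _ _]addr0 -[X in k + X](scale0r v); apply/is_derive_line.
apply: DeriveDef => //; rewrite -derive1E D2; apply: eq_Rintegral => x _.
by rewrite d1 scale0r addr0.
Qed.

Lemma cos_lipschitz (a b : R) : `|cos a - cos b| <= `|a - b|.
Proof.
wlog ab : a b / b <= a.
  by move=> H; case: (leP b a) => [/H//|/ltW/H]; rewrite distrC (distrC a).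
have [|z _ ->] := @MVT_segment R cos (fun t : R => - sin t) b a ab.
  by apply: continuous_subspaceT; exact: continuous_cos.
by rewrite normrM ler_piMl// normrN ler_norml sin_geN1 sin_le1.
Qed.

Lemma coord_le_norm i x : `|coord i x| <= `|x|.
Proof.
rewrite !prod_normE; elim/ord3_ind: i; rewrite /coord /= !le_max ?lexx ?orbT//.
Qed.

(** Directional derivatives alone do not yield joint continuity, so a Lipschitz bound is proved
    directly: the cosine is 1-Lipschitz, and [dot (k - k') x] is at most the sup norm of [k - k']
    times the sum of the absolute coordinates of [x]. *)
Lemma continuous_trig_transform h c : rapid h -> continuous (trig_transform h c).
Proof.
move=> rh.
pose B x : R := \sum_(i < 3) `|coord i x * h x|.
have iB : (leb3 R).-integrable setT (EFin \o B).
  rewrite (_ : _ \o _ = fun x => (\sum_(i < 3) (abse \o (EFin \o (fun x =>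
    (coord i x * h x)%R))) x)%E); last first.
    by apply/funext => x; rewrite /B /= sumEFin.
  apply: integrable_sum => // i _.
  by apply: integrable_abse; apply: rapid_integrable; exact: rapid_coord.
have ihc k := rapid_integrable (rapid_cos k c rh).
pose L := \int[leb3 R]_x B x.
have lip k k' : `|trig_transform h c k - trig_transform h c k'| <= `|k - k'| * L.
  rewrite /trig_transform -RintegralB//.
  have iD : (leb3 R).-integrable setT (EFin \o (fun x =>
    h x * cos (dot k x + c) - h x * cos (dot k' x + c))).
    by have := integrableB measurableT (ihc k) (ihc k'); congr (_.-integrable _ _).
  apply: le_trans (le_normr_Rintegral _ iD) _ => //.
  rewrite /L -RintegralZl//; apply: le_Rintegral => //.
  - exact: (integrable_abse iD).
  - exact: (integrableZl measurableT _ iB).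
  - move=> x _; rewrite -mulrBr normrM.
    apply: (@le_trans _ _ (`|h x| * `|dot (k - k') x|)).
      rewrite ler_wpM2l//; apply: le_trans (cos_lipschitz _ _) _.
      by rewrite dotDl dotNl opprD addrACA subrr addr0.
    rewrite /B mulr_sumr /dot mulrC; apply: le_trans (ler_wpM2r _ (ler_norm_sum _ _
      _)) _ => //.
    rewrite mulr_suml; apply: ler_sum => i _.
    by rewrite normrM -mulrA -normrM ler_wpM2r// coord_le_norm.
move=> k; apply/cvgrPdist_le => e e0.
have L0 : 0 <= L by apply: Rintegral_ge0 => x _; apply: sumr_ge0.
near=> k'; apply: le_trans (lip k k') _.
apply: (@le_trans _ _ (`|k - k'| * (L + 1))); first by rewrite ler_wpM2l ?lerDl.
rewrite -ler_pdivlMr ?ltr_wpDl//; near: k'.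
by apply: (@cvgr_dist_le _ _ _ _ _ id k) => //; rewrite divr_gt0// ltr_wpDl.
Unshelve. all: by end_near. Qed.

End TrigTransform.

(** * Integration by parts on R^3 *)

Section IntegrationByParts.
Context {R : realType}.
Local Notation mu := (@lebesgue_measure R).

(** On [[- a n, a n]] the integral is a difference of boundary values of [F], which tend to [0] by
    the decay of [F]; the decay of [f] lets dominated convergence reach the whole line. *)
Lemma integral_derivative_eq0 (F f : R -> R) (M : R) :
  (forall t, is_derive t (1 : R) F (f t)) -> continuous f ->
  (forall t, `|F t| <= M * (oneDsqr t)^-1) ->
  (forall t, `|f t| <= M * (oneDsqr t)^-1) ->
  (\int[mu]_t (f t)%:E = 0)%E.
Proof.
move=> dF cf FM fM.
pose a n : R := n.+1%:R.
have a0 n : 0 < a n by rewrite /a.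
have cF : continuous F.
  by move=> t; apply/differentiable_continuous/derivable1_diffP; have [] := dF t.
have ftc n : (\int[mu]_(t in `[(- a n)%R, a n]) (f t)%:E = (F (a n) - F (- a n))%:E)%E.
  rewrite EFinB; apply: continuous_FTC2.
  - by have := a0 n; lra.
  - exact: continuous_subspaceT.
  - split => [t _||]; first by have [] := dF t.
    + by apply: cvg_at_right_filter; exact: cF.
    + by apply: cvg_at_left_filter; exact: cF.
  - by move=> t _; rewrite derive1E; have [] := dF t.
have mf : measurable_fun setT f by exact: continuous_measurable_fun.
have iM : mu.-integrable setT (EFin \o (fun t => M * (oneDsqr t)^-1)).
  exact: (integrableZl measurableT M integrable_oneDsqrV).
have cvgf : (\int[mu]_t ((f \_ `[(- a n)%R, a n]) t)%:E)%E @[n --> \oo] -->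
    (\int[mu]_t (f t)%:E)%E.
  apply: (@dominated_cvg _ _ _ mu _ _ (fun n t => ((f \_ `[(- a n)%R, a n]) t)%:E) _
    (EFin \o (fun t => M * (oneDsqr t)^-1))) => //.
  - by move=> n; apply/measurable_EFinP; apply/(measurable_restrictT _ _).1 => //;
    exact: measurable_funTS.
  - move=> t _; apply: cvg_near_cst; near=> n; congr EFin;
    rewrite patchE ifT// inE/= in_itv/=.
    rewrite -ler_norml; apply: (@le_trans _ _ n%:R); last by rewrite ler_nat.
    by near: n; exact: nbhs_infty_ger.
  - move=> n t _; rewrite /= lee_fin patchE; case: ifPn => _ //.
    by rewrite normr0 (le_trans _ (fM t)).
have cvg0 : (F (a n) - F (- a n))%:E @[n --> \oo] --> (0 : R)%:E.
  apply: cvg_EFin; first exact: nearW.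
  have M0 : 0 <= M.
    by have := le_trans (normr_ge0 _) (FM 0); rewrite pmulr_lge0// oneDsqrV_gt0.
  (* For [n] beyond [M / (e / 2)] one has [M <= e / 2 * n], and [n] is at most [1 + a n ^ 2]; each
     boundary value is then at most [e / 2]. *)
  apply/cvgr0Pnorm_le => e e0; near=> n.
  have bF (t : R) : `|t| = a n -> `|F t| <= e / 2.
    move=> ta; apply: le_trans (FM t) _.
    rewrite ler_pdivrMr ?oneDsqr_gt0//.
    apply: (@le_trans _ _ (e / 2 * n%:R)).
      rewrite mulrC -ler_pdivrMr ?divr_gt0//; near: n; exact: nbhs_infty_ger.
    rewrite ler_wpM2l ?divr_ge0 ?ltW// /oneDsqr -real_normK ?num_real// ta /a.
    by rewrite -natr1; have : 0 <= n%:R :> R by []; nra.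
  rewrite /= (splitr e) (le_trans (ler_normB _ _))// lerD// bF ?normrN ?gtr0_norm//.
apply: cvg_unique cvgf _ => //.
apply: cvg_trans cvg0; apply: near_eq_cvg; near=> n.
by rewrite -ftc integral_mkcond restrict_EFin.
Unshelve. all: by end_near. Qed.

(** Fubini alone gives integrable slices for almost every [z]; the pointwise bound by [decay] gives
    them for every [z], so the inner double integral can itself be split. *)
Lemma integrable_slice (f : R3 R -> R) M z : measurable_fun setT f ->
  (forall x, `|f x| <= M * decay x) ->
  (@leb2 R).-integrable setT (fun w => (f (w, z))%:E).
Proof.
move=> mf fM.
pose g (w : R * R) : R := M * (oneDsqr z)^-1 * ((oneDsqr w.1)^-1 * (oneDsqr w.2)^-1).
apply: (@integrable_bounded _ _ R leb2 (fun w => f (w, z)) g).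
- exact: (measurable_fun_pair1 _ mf).
- by move=> w; apply: le_trans (fM _) _; rewrite /decay/g /=; lra.
- have := integrable_tensor (@integrable_oneDsqrV R) (@integrable_oneDsqrV R).
  by move=> /(integrableZl measurableT (M * (oneDsqr z)^-1)); congr (_.-integrable _ _).
Qed.

(** The order of the iterated integrals over [(R * R) * R] is chosen according to [i], so that the
    [i]-th variable is innermost; that inner integral already vanishes. The condition
    [coord i x = 0] picks one base point on each line. *)
Lemma integral_leb3_line_eq0 i (f : R3 R -> R) M : measurable_fun setT f ->
  (forall x, `|f x| <= M * decay x) ->
  (forall x, coord i x = 0 ->
    (\int[mu]_t (f (x + t *: basis R i))%:E = 0)%E) ->
  (\int[leb3 R]_x (f x)%:E = 0)%E.
Proof.
move=> mf fM; have jf := integrable_le_decay mf fM.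
have j2 z := integrable_slice z mf fM.
have E := @integral21_prod_meas1 _ _ _ _ R (@leb2 R) (@lebesgue_measure R) (EFin \o f) jf.
elim/ord3_ind: i => H.
- rewrite -[LHS]E; apply: integral0_eq => z _; rewrite /fubini_G.
  rewrite -(@integral21_prod_meas1 _ _ _ _ R mu mu _ (j2 z)).
  apply: integral0_eq => y _; rewrite /fubini_G -[RHS](H (0, y, z) erefl).
  apply: eq_integral => t _; congr (f _)%:E.
  rewrite /basis /= -[RHS]/(_ + t * _, _ + t * _, _ + t * _) /=.
  by rewrite ?mulr1 ?mulr0 ?addr0 ?add0r -?surjective_pairing.
- rewrite -[LHS]E; apply: integral0_eq => z _; rewrite /fubini_G.
  rewrite -(@integral12_prod_meas1 _ _ _ _ R mu mu _ (j2 z)).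
  apply: integral0_eq => y _; rewrite /fubini_F -[RHS](H (y, 0, z) erefl).
  apply: eq_integral => t _; congr (f _)%:E.
  rewrite /basis /= -[RHS]/(_ + t * _, _ + t * _, _ + t * _) /=.
  by rewrite ?mulr1 ?mulr0 ?addr0 ?add0r -?surjective_pairing.
- rewrite -[LHS](@integral12_prod_meas1 _ _ _ _ R (@leb2 R) (@lebesgue_measure R)
  (EFin \o f) jf).
  apply: integral0_eq => z _; rewrite /fubini_F -[RHS](H (z, 0) erefl).
  apply: eq_integral => t _; congr (f _)%:E.
  rewrite /basis /= -[RHS]/(_ + t * _, _ + t * _, _ + t * _) /=.
  by rewrite ?mulr1 ?mulr0 ?addr0 ?add0r -?surjective_pairing.
Qed.

End IntegrationByParts.

Section PartialIntegration.
Context {R : realType}.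
Implicit Types (k v x y : R3 R) (h : R3 R -> R) (c : R).

Lemma decay_le_coord i x : decay x <= (oneDsqr (coord i x))^-1.
Proof.
have h (t : R) : 0 <= (oneDsqr t)^-1 <= 1 by rewrite ltW ?oneDsqrV_gt0//= oneDsqrV_le1.
have /andP[p1 q1] := h x.1.1; have /andP[p2 q2] := h x.1.2; have /andP[p3 q3] := h x.2.
rewrite /decay; elim/ord3_ind: i; rewrite /coord /=.
- by rewrite -mulrA ler_piMr// mulr_ile1.
- by rewrite mulrAC ler_piMl// mulr_ile1.
- by rewrite ler_piMl// mulr_ile1.
Qed.

Lemma continuous_dot k : continuous (dot k : R3 R -> R).
Proof.
move=> x; rewrite (_ : dot k = (fun y => k.1.1 * y.1.1 + k.1.2 * y.1.2 + k.2 * y.2));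
  last first.
  by apply/funext => y; rewrite dotE.
apply: cvgD; [apply: cvgD|]; (apply: cvgM; first exact: cvg_cst).
- exact: (@continuous_coord R ord0).
- exact: (@continuous_coord R (lift ord0 ord0)).
- exact: (@continuous_coord R (lift ord0 (lift ord0 ord0))).
Qed.

Lemma continuous_cos_phase k c : continuous (fun x => cos (dot k x + c)).
Proof.
move=> x; apply: (@continuous_comp _ _ _ (fun x => dot k x + c) cos).
  by apply: cvgD; [exact: continuous_dot|exact: cvg_cst].
exact: continuous_cos.
Qed.

Lemma is_derive_cos_phase k v c x : is_derive x v (fun x => cos (dot k x + c))
  (dot k v * cos (dot k x + (c + pi / 2))).
Proof.
rewrite -[X in is_derive X _ _ _]addr0 -[X in x + X](scale0r v); apply/is_derive_line.
have -> : (fun s : R => cos (dot k (x + s *: v) + c)) =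
    cos \o (fun s => s * dot k v + (dot k x + c)).
  by apply/funext => s /=; rewrite dotC dotDl dotZl -!(dotC k); congr cos; ring.
have D : is_derive (0 : R) (1 : R) (fun t : R => t * dot k v + (dot k x + c)) (dot k v).
  by apply: is_derive_eq; rewrite /= ?scaler0 ?scaler1 ?addr0 ?add0r -?[_ *: _]/(_ *
    _) ?mulr1 ?mul1r.
have D' := @is_derive1_comp R cos
  (fun t => t * dot k v + (dot k x + c)) 0 _ _ (is_derive_cos _) D.
apply: is_derive_eq D' _.
by rewrite (addrA (dot k x)) cosDpihalf mul0r add0r mulrC.
Qed.

Lemma Rintegral_partial_eq0 i (F f : R3 R -> R) : rapid F -> rapid f ->
  continuous f -> (forall x, is_derive x (basis R i) F (f x)) ->
  \int[leb3 R]_x f x = 0.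
Proof.
move=> rF rf cf dF; rewrite /Rintegral.
have [M1 M10 FM] := rapid_decay rF; have [M2 M20 fM] := rapid_decay rf.
rewrite (integral_leb3_line_eq0 (i := i) (proj1 rf) fM)// => x xi.
have le t : decay (x + t *: basis R i) <= (oneDsqr t)^-1.
  have := decay_le_coord i (x + t *: basis R i).
  by rewrite coordD coordZ coord_basis xi eqxx mulr1 add0r.
apply: (@integral_derivative_eq0 R (fun t => F (x + t *: basis R i))
  (* [M1] bounds the primitive and [M2] the derivative; their sum is a common constant. *)
  (fun t => f (x + t *: basis R i)) (M1 + M2)).
- by move=> t; exact: (proj1 (is_derive_line F x (basis R i) t _) (dF _)).
- move=> t; apply: (@continuous_comp _ _ _ (fun t : R => x + t *: basis R i) f).
    by apply: cvgD; [exact: cvg_cst|apply: cvgZr_tmp => //; exact: cvg_id].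
  exact: cf.
- move=> t; apply: le_trans (FM _) _; apply: ler_pM => //.
    by rewrite ltW ?decay_gt0.
  by rewrite lerDl.
- move=> t; apply: le_trans (fM _) _; apply: ler_pM => //.
    by rewrite ltW ?decay_gt0.
  by rewrite lerDr.
Qed.

(** The [i]-th partial derivative of [h x * cos (dot k x + c)] has integral zero, and the product
    rule splits it into the two transforms. *)
Lemma trig_transform_partial i h h' c k : rapid h -> rapid h' ->
  continuous h -> continuous h' ->
  (forall x, is_derive x (basis R i) h (h' x)) ->
  trig_transform h' c k = - (coord i k * trig_transform h (c + pi / 2) k).
Proof.
move=> rh rh' ch ch' dh.
have r1 := rapid_cos k c rh'.
have r2 := rapidZ (coord i k) (rapid_cos k (c + pi / 2) rh).
have := @Rintegral_partial_eq0 i (fun x => h x * cos (dot k x + c))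
  (fun x => h' x * cos (dot k x + c) + coord i k * (h x * cos (dot k x + (c + pi / 2)))).
rewrite RintegralD//; [|exact: rapid_integrable|exact: rapid_integrable].
rewrite RintegralZl//; last exact: rapid_integrable (rapid_cos k (c + pi / 2) rh).
move=> H; apply/eqP; rewrite -addr_eq0; apply/eqP; apply: H.
- exact: rapid_cos.
- exact: rapidD.
- move=> x; apply: cvgD; [|apply: cvgM; first exact: cvg_cst]; apply: cvgM;
    by [exact: ch|exact: ch'|exact: continuous_cos_phase].
- move=> x.
  apply: is_derive_eq (is_deriveM (dh x) (is_derive_cos_phase k (basis R i) c x)) _.
  rewrite (dotC k) dot_basis -![_ *: _]/(_ * _); ring.
Qed.

End PartialIntegration.

(** * Gaussians *)

Lemma ge0_integralZl_real d (T : measurableType d) (R : realType)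
    (mu : {measure set T -> \bar R}) (r : R) (f : T -> R) :
  0 <= r -> measurable_fun setT f -> (forall x, 0 <= f x) ->
  (\int[mu]_x (r * f x)%:E = r%:E * \int[mu]_x (f x)%:E)%E.
Proof.
move=> r0 mf f0; rewrite -ge0_integralZl_EFin//; last exact/measurable_EFinP.
by move=> x _; rewrite lee_fin.
Qed.

Section Gaussian.
Context {R : realType}.
Implicit Types (k v x y z : R3 R) (h : R3 R -> R) (s c : R).

(** With [N = n + 1], [exp y = (exp (y / N)) ^ N >= (y / N) ^ N] for [y >= 0], applied to
    [y = s t^2]. *)
Lemma normX_expR_bound s n : 0 < s ->
  exists M : R, forall t : R, `|t ^+ n * expR (- (s * t ^+ 2))| <= M.
Proof.
(* The summand [1] covers [|t| <= 1]. The other covers [|t| > 1], where [|t|^n <= (t^2)^(n+1)]. *)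
move=> s0; exists (1 + (n.+1%:R / s) ^+ n.+1) => t.
have K (y : R) : 0 <= y -> (y / n.+1%:R) ^+ n.+1 <= expR y.
  move=> y0; rewrite -[X in expR X](@divfK _ n.+1%:R) ?pnatr_eq0// expRM_natr.
  rewrite lerXn2r ?nnegrE ?divr_ge0 ?expR_ge0//.
  by apply: le_trans (expR_ge1Dx _); rewrite lerDr.
have st0 : 0 <= s * t ^+ 2 by rewrite mulr_ge0 ?sqr_ge0// ltW.
rewrite normrM (gtr0_norm (expR_gt0 _)) expRN ler_pdivrMr ?expR_gt0// normrX mulrDl mul1r.
have [t1|t1] := leP `|t| 1.
  apply: (@le_trans _ _ 1); first by rewrite exprn_ile1.
  rewrite -[X in X <= _]addr0 lerD//; first by apply: le_trans (expR_ge1Dx _);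
    rewrite lerDl.
  by rewrite mulr_ge0 ?expR_ge0// exprn_ge0// divr_ge0// ltW.
apply: (@le_trans _ _ ((t ^+ 2) ^+ n.+1)).
  rewrite -(real_normK (num_real t)) -exprM ler_weXn2l// ?ltW//.
  by rewrite mul2n -addnn addSn leqW// leq_addr.
rewrite -[X in X <= _]add0r lerD ?expR_ge0//.
apply: le_trans (ler_wpM2l _ (K _ st0)); last by rewrite exprn_ge0// divr_ge0// ltW.
rewrite -exprMn lerXn2r ?nnegrE ?sqr_ge0//.
  by rewrite mulr_ge0// divr_ge0// ltW.
have -> : n.+1%:R / s * (s * t ^+ 2 / n.+1%:R) = t ^+ 2.
  have : n.+1%:R != 0 :> R by rewrite pnatr_eq0.
  by move: n.+1%:R => N N0; field; rewrite N0 gt_eqF.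
by [].
Qed.

Definition gauss s x : R := expR (- (s * sqnorm x)).

Lemma gaussE s x : gauss s x = expR (- (s * x.1.1 ^+ 2)) *
  expR (- (s * x.1.2 ^+ 2)) * expR (- (s * x.2 ^+ 2)).
Proof. by rewrite /gauss sqnormE -!expRD; congr expR; ring. Qed.

Lemma continuous_sqnorm : continuous (@sqnorm R).
Proof.
move=> x; rewrite (_ : @sqnorm R = (fun y =>
  y.1.1 * y.1.1 + y.1.2 * y.1.2 + y.2 * y.2)); last first.
  by apply/funext => y; rewrite sqnormE !expr2.
apply: cvgD; [apply: cvgD|]; apply: cvgM;
  by [exact: (@continuous_coord R ord0)|exact: (@continuous_coord R (lift ord0 ord0))
     |exact: (@continuous_coord R (lift ord0 (lift ord0 ord0)))].
Qed.

Lemma continuous_gauss s : continuous (gauss s).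
Proof.
move=> x; apply: (@continuous_comp _ _ _ (fun x => - (s * sqnorm x)) expR).
  by apply: cvgN; apply: cvgM; [exact: cvg_cst|exact: continuous_sqnorm].
exact: continuous_expR.
Qed.

Lemma rapid_gauss s : 0 < s -> rapid (gauss s).
Proof.
move=> s0; split; first by apply: continuous_measurable3; exact: continuous_gauss.
move=> a.
have [M0 h0] := normX_expR_bound (a ord0) s0.
have [M1 h1] := normX_expR_bound (a (lift ord0 ord0)) s0.
have [M2 h2] := normX_expR_bound (a (lift ord0 (lift ord0 ord0))) s0.
exists (M0 * M1 * M2) => x; rewrite monomialE gaussE.
rewrite (_ : _ * _ = (x.1.1 ^+ a ord0 * expR (- (s * x.1.1 ^+ 2))) *
  (x.1.2 ^+ a (lift ord0 ord0) * expR (- (s * x.1.2 ^+ 2))) *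
  (x.2 ^+ a (lift ord0 (lift ord0 ord0)) * expR (- (s * x.2 ^+ 2)))); last by ring.
by rewrite 2!normrM !ler_pM// mulr_ge0.
Qed.

Lemma is_derive_gauss s v x :
  is_derive x v (gauss s) (- (2 * s * dot v x) * gauss s x).
Proof.
rewrite -[X in is_derive X _ _ _]addr0 -[X in x + X](scale0r v); apply/is_derive_line.
have -> : (fun t : R => gauss s (x + t *: v)) =
    expR \o (fun t => - s * sqnorm v * (t * t) - 2 * s * dot v x * t - s * sqnorm x).
  apply/funext => t /=; rewrite /gauss /sqnorm dotDl dotZl !(dotC _ (x + _)) !dotDl
    !dotZl (dotC x v).
  by congr expR; ring.
have D : is_derive (0 : R) (1 : R) (fun t =>
  - s * sqnorm v * (t * t) - 2 * s * dot v x * t - s * sqnorm x) (- (2 * s * dot v x)).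
  by apply: is_derive_eq; rewrite -![_ *: _]/(_ * _); ring.
apply: is_derive_eq (@is_derive1_comp R expR _ _ _ _ (is_derive_expR _) D) _.
by rewrite /gauss mulrC; congr (_ * expR _); ring.
Qed.

(** This is the total mass of the centred normal law of variance [1 / (2 s)], whose peak value is
    the inverse of [sqrt (pi / s)]. *)
Lemma integral_gauss1 s : 0 < s ->
  (\int[@lebesgue_measure R]_t (expR (- (s * t ^+ 2)))%:E = (Num.sqrt (pi / s))%:E)%E.
Proof.
move=> s0; pose sg : R := (Num.sqrt (2 * s))^-1.
have sg2 : sg ^+ 2 *+ 2 = s^-1.
  rewrite /sg exprVn sqr_sqrtr ?mulr_ge0 ?ltW// -mulr_natr; field; rewrite gt_eqF//.
have sg0 : sg != 0 by rewrite invr_eq0 sqrtr_eq0 -ltNge mulr_gt0.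
have E t : (normal_peak sg * normal_fun 0 sg t) = (Num.sqrt (pi / s))^-1 * expR (- (s
  * t ^+ 2)).
  rewrite /normal_peak /normal_fun subr0 sg2 invrK.
  rewrite -mulrnAl sg2 (mulrC pi); congr (_ * expR _); ring.
have := integral_normal_pdf (0 : R) sg; rewrite normal_pdfE//.
have -> : (\int[@lebesgue_measure R]_t (normal_peak sg * normal_fun 0 sg t)%:E =
    \int[@lebesgue_measure R]_t ((Num.sqrt (pi / s))^-1 * (expR (- (s * t ^+ 2))))%:E)%E.
  by apply: eq_integral => t _; rewrite E.
have cg : continuous (fun t : R => expR (- (s * t ^+ 2))).
  move=> t; apply: (@continuous_comp _ _ _ (fun t : R => - (s * t ^+ 2)) expR).
    by apply: cvgN; apply: cvgM; [exact: cvg_cst|exact: exprn_continuous].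
  exact: continuous_expR.
rewrite ge0_integralZl_real ?invr_ge0 ?sqrtr_ge0//; last first.
  by apply: continuous_measurable_fun; exact: cg.
have p0 : Num.sqrt (pi / s) != 0 by rewrite sqrtr_eq0 -ltNge divr_gt0 ?pi_gt0.
move=> /(congr1 (mule (Num.sqrt (pi / s))%:E)).
by rewrite muleA -EFinM mulfV// mul1e mule1.
Qed.

Lemma integral_gauss s : 0 < s ->
  (\int[leb3 R]_x (gauss s x)%:E = ((Num.sqrt (pi / s)) ^+ 3)%:E)%E.
Proof.
move=> s0; set I := Num.sqrt (pi / s).
pose e (t : R) := expR (- (s * t ^+ 2)).
have ce : continuous e.
  move=> t; apply: (@continuous_comp _ _ _ (fun t : R => - (s * t ^+ 2)) expR).
    by apply: cvgN; apply: cvgM; [exact: cvg_cst|exact: exprn_continuous].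
  exact: continuous_expR.
have me : measurable_fun setT e by exact: continuous_measurable_fun.
have Ie : (\int[@lebesgue_measure R]_t (e t)%:E = I%:E)%E by exact: integral_gauss1.
have mg : measurable_fun setT (EFin \o gauss s).
  by apply/measurable_EFinP; exact: (rapid_gauss s0).1.
rewrite (@fubini_tonelli1 _ _ _ _ R (@leb2 R) (@lebesgue_measure R) (EFin \o gauss s)
  mg); last first.
  by move=> x; rewrite lee_fin expR_ge0.
have e0 t : 0 <= e t by exact: expR_ge0.
have inner w : (fubini_F (@lebesgue_measure R) (EFin \o gauss s) w = (I * (e w.1 * e
  w.2))%:E)%E.
  rewrite [RHS]EFinM muleC -Ie -ge0_integralZl_real ?mulr_ge0//.
  by apply: eq_integral => t _; rewrite /= gaussE.
transitivity (\int[@leb2 R]_w (I * (e w.1 * e w.2))%:E)%E.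
  by apply: eq_integral => w _; exact: inner.
have mee : measurable_fun setT (fun w : R * R => e w.1 * e w.2).
  by apply: measurable_funM; apply: measurableT_comp => //.
rewrite ge0_integralZl_real ?sqrtr_ge0//; last by move=> w; rewrite mulr_ge0.
rewrite exprS EFinM; congr (_ * _)%E.
rewrite (@fubini_tonelli1 _ _ _ _ R (@lebesgue_measure R) (@lebesgue_measure R)
  (EFin \o (fun w : R * R => e w.1 * e w.2))); last 2 first.
- exact/measurable_EFinP.
- by move=> x; rewrite lee_fin mulr_ge0// expR_ge0.
have inner1 t : (fubini_F (@lebesgue_measure R) (EFin \o (fun w : R * R =>
  (e w.1 * e w.2)%R)) t = (I * e t)%:E)%E.
  by rewrite [RHS]EFinM muleC -Ie -ge0_integralZl_real.
transitivity (\int[@lebesgue_measure R]_t (I * e t)%:E)%E.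
  by apply: eq_integral => t _; exact: inner1.
by rewrite ge0_integralZl_real ?sqrtr_ge0// Ie -EFinM expr2.
Qed.

(** Along the ray [t *: z] the transform [J] solves [J' = - (t |z|^2 / (2 s)) J]: differentiation
    and integration by parts each shift the phase by [pi / 2], and the total shift [pi] gives the
    sign. Hence [J t * exp (t^2 |z|^2 / (4 s))] is constant, and it is evaluated at [t = 0]. *)
Lemma trig_transform_gauss s c z : 0 < s ->
  trig_transform (gauss s) c z =
  cos c * Num.sqrt (pi / s) ^+ 3 * expR (- (sqnorm z / (4 * s))).
Proof.
move=> s0; have rg := rapid_gauss s0.
have sn0 : s != 0 by rewrite gt_eqF.
(* [coord i x * gauss s x] is [- 1 / (2 s)] times the [i]-th partial derivative of [gauss s]. *)
have coordg i d k : trig_transform (fun x => coord i x * gauss s x) d k =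
    coord i k / (2 * s) * trig_transform (gauss s) (d + pi / 2) k.
  have rc := rapid_coord i rg.
  have rc' := rapidZ (- (2 * s)) rc.
  have H : - (2 * s) * trig_transform (fun x => coord i x * gauss s x) d k =
      - (coord i k * trig_transform (gauss s) (d + pi / 2) k).
    have ch' : continuous (fun x => - (2 * s) * (coord i x * gauss s x)).
      move=> x; apply: cvgM; first exact: cvg_cst.
      by apply: cvgM; [exact: continuous_coord|exact: continuous_gauss].
    have dg x : is_derive x (basis R i) (gauss s) (- (2 * s) * (coord i x * gauss s x)).
      apply: is_derive_eq (is_derive_gauss s (basis R i) x) _.
      by rewrite dot_basis; ring.
    rewrite -(trig_transform_partial d k rg rc' (@continuous_gauss s) ch' dg).
    rewrite /trig_transform -RintegralZl//;
      last exact: rapid_integrable (rapid_cos _ _ rc).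
    by apply: eq_Rintegral => x _; rewrite !mulrA.
  apply: (@mulfI _ (- (2 * s))); first by rewrite oppr_eq0 mulf_neq0 ?pnatr_eq0.
  by rewrite H; field.
have trig_pi d k : trig_transform (gauss s) (d + pi) k = - trig_transform (gauss s) d k.
  rewrite /trig_transform -mulN1r -RintegralZl//;
    last exact: rapid_integrable (rapid_cos _ _ rg).
  by apply: eq_Rintegral => x _; rewrite addrA cosDpi; ring.
have dotg d k v : trig_transform (fun x => dot v x * gauss s x) d k =
    dot v k / (2 * s) * trig_transform (gauss s) (d + pi / 2) k.
  have rc i := rapid_cos k d (rapid_coord i rg).
  have r i := rapidZ (coord i v) (rc i).
  transitivity (\sum_(i < 3) coord i v * trig_transform (fun x =>
    coord i x * gauss s x) d k).
    rewrite !big_ord_recl big_ord0 addr0 /trig_transform.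
    rewrite -!RintegralZl//; try exact: rapid_integrable (rc _).
    rewrite -RintegralD//; try exact: rapid_integrable (r _).
    rewrite -RintegralD//; first last.
    - exact: rapid_integrable (rapidD (r _) (r _)).
    - exact: rapid_integrable (r _).
    by apply: eq_Rintegral => x _; rewrite dotE /coord /=; ring.
  under eq_bigr do rewrite coordg.
  by rewrite !big_ord_recl big_ord0 dotE /coord /=; field.
pose J (t : R) := trig_transform (gauss s) c (t *: z).
have dJ t : is_derive t (1 : R) J (- (t * sqnorm z / (2 * s)) * J t).
  have := is_derive_trig_transform c (0 + t *: z) z rg.
  rewrite is_derive_line dotg -addrA -splitr trig_pi add0r.
  have -> : (fun s0 : R => trig_transform (gauss s) c (0 + s0 *: z)) = J.
    by apply/funext => u; rewrite add0r.
  move=> D; apply: is_derive_eq D _; rewrite /J dotC dotZl -/(sqnorm z); ring.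
pose K (t : R) := J t * expR (t * t * (sqnorm z / (4 * s))).
have dE t : is_derive t (1 : R) (fun t : R => expR (t * t * (sqnorm z / (4 * s))))
    (expR (t * t * (sqnorm z / (4 * s))) * (2 * t * (sqnorm z / (4 * s)))).
  have D : is_derive t (1 : R) (fun t : R =>
    t * t * (sqnorm z / (4 * s))) (2 * t * (sqnorm z / (4 * s))).
    by apply: is_derive_eq; rewrite -![_ *: _]/(_ * _); ring.
  exact: (@is_derive1_comp R expR _ _ _ _ (is_derive_expR _) D).
have dK t : is_derive t (1 : R) K 0.
  apply: is_derive_eq (is_deriveM (dJ t) (dE t)) _.
  by rewrite -![_ *: _]/(_ * _); field.
have := is_derive_0_is_cst 1 0 dK.
rewrite /K /J scale1r scale0r mul1r !mul0r expR0 mulr1 mul1r => JE.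
rewrite expRN -[LHS](mulfK (x := expR (sqnorm z / (4 * s)))) ?gt_eqF ?expR_gt0// JE.
congr (_ / _); rewrite /trig_transform.
under eq_Rintegral => x _ do rewrite -[0](scale0r x) dotZl mul0r add0r mulrC.
rewrite RintegralZl//; last exact: rapid_integrable rg.
by congr (_ * _); rewrite /Rintegral integral_gauss.
Qed.

End Gaussian.

(** Real-valued integrals are [fine] of extended ones, which sends infinite values to [0].
    Integrability of every slice keeps all inner integrals finite, so the extended Fubini theorem
    transfers without exceptional points. *)
Lemma Rintegral_fubini d1 d2 (T1 : measurableType d1) (T2 : measurableType d2)
    (R : realType) (m1 : {sigma_finite_measure set T1 -> \bar R})
    (m2 : {sigma_finite_measure set T2 -> \bar R}) (f : T1 -> T2 -> R) :
  (m1 \x m2)%E.-integrable setT (fun z => (f z.1 z.2)%:E) ->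
  (forall x, m2.-integrable setT (EFin \o f x)) ->
  (forall y, m1.-integrable setT (EFin \o f ^~ y)) ->
  \int[m1]_x \int[m2]_y f x y = \int[m2]_y \int[m1]_x f x y.
Proof.
move=> jf j2 j1; congr fine.
transitivity (\int[m1]_x \int[m2]_y (f x y)%:E)%E.
  by apply: eq_integral => x _; rewrite fineK//; exact: integrable_fin_num (j2 x).
transitivity (\int[m2]_y \int[m1]_x (f x y)%:E)%E; first exact: (Fubini jf).
by apply: eq_integral => y _; rewrite fineK//; exact: integrable_fin_num (j1 y).
Qed.

(** * Real and imaginary parts *)

Section ComplexParts.
Context {R : realType}.
Implicit Types z w : R[i].

Lemma ReM z w : Re (z * w) = Re z * Re w - Im z * Im w.
Proof. by case: z; case: w. Qed.

Lemma ImM z w : Im (z * w) = Re z * Im w + Im z * Re w.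
Proof. by case: z => a b; case: w => c d /=; rewrite addrC addrC. Qed.

Lemma ReD z w : Re (z + w) = Re z + Re w.
Proof. by case: z; case: w. Qed.

Lemma ImD z w : Im (z + w) = Im z + Im w.
Proof. by case: z; case: w. Qed.

Lemma ReRM (r : R) z : Re (r%:C * z) = r * Re z.
Proof. by rewrite ReM /= mul0r subr0. Qed.

Lemma ImRM (r : R) z : Im (r%:C * z) = r * Im z.
Proof. by rewrite ImM /= mul0r addr0. Qed.

Lemma complex_ext z w : Re z = Re w -> Im z = Im w -> z = w.
Proof. by case: z => a b; case: w => c d /= -> ->. Qed.

Lemma normc_ge_absRe z : `|Re z| <= normc z.
Proof.
case: z => a b /=; rewrite -sqrtr_sqr ler_sqrt ?addr_ge0 ?sqr_ge0//.
by rewrite lerDl sqr_ge0.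
Qed.

Lemma normc_ge_absIm z : `|Im z| <= normc z.
Proof.
case: z => a b /=; rewrite -sqrtr_sqr ler_sqrt ?addr_ge0 ?sqr_ge0//.
by rewrite lerDr sqr_ge0.
Qed.

Lemma normc_le_absD z : normc z <= `|Re z| + `|Im z|.
Proof.
case: z => a b /=; rewrite -[leRHS]ger0_norm ?addr_ge0// -sqrtr_sqr.
rewrite ler_sqrt ?sqr_ge0// sqrrD !real_normK ?num_real//.
by rewrite -addrA lerD2l lerDr mulrn_wge0// mulr_ge0.
Qed.

Lemma normcR (r : R) : normc r%:C = `|r|.
Proof. by rewrite /= expr0n /= addr0 sqrtr_sqr. Qed.

Lemma normc_ge0 z : 0 <= normc z.
Proof. by case: z => a b; exact: sqrtr_ge0. Qed.

End ComplexParts.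

(** * Schwartz functions made from a Gaussian and Fourier integrals *)

Section GaussClass.
Context {R : realType} (s : R).
Hypothesis s0 : 0 < s.
Implicit Types (f h : R3 R -> R).

(* Spans the functions obtained by differentiating products of the Gaussian
   with Fourier transforms. *)
Inductive gauss_class : (R3 R -> R) -> Prop :=
| gauss_class_base h c : rapid h ->
    gauss_class (fun k => gauss s k * trig_transform h c k)
| gauss_class_coord i f : gauss_class f -> gauss_class (fun k => coord i k * f k)
| gauss_class_add f g : gauss_class f -> gauss_class g ->
    gauss_class (fun k => f k + g k)
| gauss_class_scale c f : gauss_class f -> gauss_class (fun k => c * f k).

Lemma gauss_class_continuous f : gauss_class f -> continuous f.
Proof.
elim=> {f} [h c rh|i f _ cf|f g _ cf _ cg|c f _ cf] x.
- by apply: cvgM; [exact: continuous_gauss|exact: continuous_trig_transform].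
- by apply: cvgM; [exact: continuous_coord|exact: cf].
- by apply: cvgD; [exact: cf|exact: cg].
- by apply: cvgM; [exact: cvg_cst|exact: cf].
Qed.

(** The decay comes from the Gaussian; each transform contributes only a bounded factor. *)
Lemma gauss_class_rapid f : gauss_class f -> rapid f.
Proof.
elim=> {f} [h c rh|i f _|f g _ rf _ rg|c f _ rf].
- have [M hM] := trig_transform_bound rh.
  apply: (rapidM_bounded (rapid_gauss s0) _ (hM c)).
  by apply: continuous_measurable3; exact: continuous_trig_transform.
- exact: rapid_coord.
- exact: rapidD.
- exact: rapidZ.
Qed.

Lemma is_derive_coord i (x v : R3 R) : is_derive x v (coord i) (coord i v).
Proof.
rewrite -[X in is_derive X _ _ _]addr0 -[X in x + X](scale0r v); apply/is_derive_line.
have -> : (fun t : R => coord i (x + t *: v)) = (fun t => t * coord i v + coord i x).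
  by apply/funext => t; rewrite coordD coordZ addrC.
by apply: is_derive_eq; rewrite -![_ *: _]/(_ * _); ring.
Qed.

(** Differentiating the Gaussian produces a coordinate factor. Differentiating the transform
    replaces [h] by another [rapid] function and shifts its phase. Iterating gives all
    [partials]. *)
Lemma gauss_class_derive i f : gauss_class f -> exists2 f', gauss_class f' &
  forall x, is_derive x (basis R i) f (f' x).
Proof.
elim=> {f} [h c rh|j f cf [f' cf' df]|f g _ [f' cf' df] _ [g' cg' dg]|c f _ [f' cf' df]].
- exists (fun k => - (2 * s) * (coord i k * (gauss s k * trig_transform h c k)) +
     gauss s k * trig_transform (fun x => dot (basis R i) x * h x) (c + pi / 2) k).
    apply: gauss_class_add; first by apply/gauss_class_scale/gauss_class_coord/gauss_class_base.
    by apply: gauss_class_base; exact: rapid_dot.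
  move=> x; apply: is_derive_eq (is_deriveM (is_derive_gauss s (basis R i) x)
    (is_derive_trig_transform c x (basis R i) rh)) _.
  by rewrite dot_basis -![_ *: _]/(_ * _); ring.
- exists (fun k => (j == i)%:R * f k + coord j k * f' k).
    by apply: gauss_class_add; [exact: gauss_class_scale|exact: gauss_class_coord].
  move=> x; apply: is_derive_eq (is_deriveM (is_derive_coord j x (basis R i)) (df x)) _.
  by rewrite coord_basis -![_ *: _]/(_ * _); ring.
- exists (fun k => f' k + g' k); first exact: gauss_class_add.
  by move=> x; exact: is_deriveD.
- exists (fun k => c * f' k); first exact: gauss_class_scale.
  by move=> x; exact: (is_deriveZ c (df x)).
Qed.

Lemma gauss_class_partials (psi : R3 R -> R[i]) (t : seq 'I_3) :
  gauss_class (fun k => Re (psi k)) -> gauss_class (fun k => Im (psi k)) ->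
  gauss_class (fun k => Re (partials t psi k)) /\
  gauss_class (fun k => Im (partials t psi k)).
Proof.
move=> cr ci; elim: t => [//|i t [ih1 ih2]] /=.
have [f' cf' df] := gauss_class_derive i ih1.
have [g' cg' dg] := gauss_class_derive i ih2.
split.
- rewrite (_ : (fun k => _) = f')//; apply/funext => k /=.
  by have [] := df k.
- rewrite (_ : (fun k => _) = g')//; apply/funext => k /=.
  by have [] := dg k.
Qed.

Lemma gauss_class_schwartz (psi : R3 R -> R[i]) :
  gauss_class (fun k => Re (psi k)) -> gauss_class (fun k => Im (psi k)) ->
  schwartz psi.
Proof.
move=> cr ci; split => [t|a t]; have [c1 c2] := gauss_class_partials t cr ci.
- split; [exact: gauss_class_continuous|exact: gauss_class_continuous|move=> i x].
  have [f' _ df] := gauss_class_derive i c1.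
  have [g' _ dg] := gauss_class_derive i c2.
  by split; [have [] := df x|have [] := dg x].
- have [_ /(_ a)[M1 h1]] := gauss_class_rapid c1.
  have [_ /(_ a)[M2 h2]] := gauss_class_rapid c2.
  exists (M1 + M2) => x; apply: le_trans (normc_le_absD _) _.
  by rewrite ReRM ImRM lerD.
Qed.

End GaussClass.

(** * Fourier transform of a Gaussian times an inverse Fourier transform *)

Section FourierGauss.
Context {R : realType}.
Implicit Types (phi : R3 R -> R[i]) (k x y : R3 R).

Definition crapid phi :=
  rapid (fun x => Re (phi x)) /\ rapid (fun x => Im (phi x)).

Lemma schwartz_crapid (t : seq 'I_3) phi : schwartz phi -> crapid (partials t phi).
Proof.
move=> [sm bd]; have [cr ci _] := sm t; split; split.
- exact: continuous_measurable3.
- move=> a; have [M hM] := bd a t; exists M => x.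
  by rewrite -ReRM (le_trans (normc_ge_absRe _)).
- exact: continuous_measurable3.
- move=> a; have [M hM] := bd a t; exists M => x.
  by rewrite -ImRM (le_trans (normc_ge_absIm _)).
Qed.

Let c3 : R := ((2 * pi) ^+ 3)^-1.

Lemma cos_shift (t : R) : cos (t - pi / 2) = sin t.
Proof. by rewrite cosB cos_pihalf sin_pihalf mulr0 mulr1 add0r. Qed.

Lemma Re_inv_fourier phi k : crapid phi -> Re (inv_fourier phi k) =
  c3 * (trig_transform (fun x => Re (phi x)) 0 k
        - trig_transform (fun x => Im (phi x)) (- (pi / 2)) k).
Proof.
move=> [rr ri]; rewrite /inv_fourier ReRM /=; congr (_ * _).
rewrite /trig_transform -RintegralB//; last 2 first.
- exact: rapid_integrable (rapid_cos k _ rr).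
- exact: rapid_integrable (rapid_cos k _ ri).
by apply: eq_Rintegral => x _; rewrite ReM /= (dotC k) addr0 cos_shift.
Qed.

Lemma Im_inv_fourier phi k : crapid phi -> Im (inv_fourier phi k) =
  c3 * (trig_transform (fun x => Re (phi x)) (- (pi / 2)) k
        + trig_transform (fun x => Im (phi x)) 0 k).
Proof.
move=> [rr ri]; rewrite /inv_fourier ImRM /=; congr (_ * _).
rewrite /trig_transform -RintegralD//; last 2 first.
- exact: rapid_integrable (rapid_cos k _ rr).
- exact: rapid_integrable (rapid_cos k _ ri).
by apply: eq_Rintegral => x _; rewrite ImM /= (dotC k) addr0 cos_shift.
Qed.

Lemma schwartz_gauss_inv_fourier (s : R) phi : 0 < s -> crapid phi ->
  schwartz (fun k => (gauss s k)%:C * inv_fourier phi k).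
Proof.
move=> s0 rphi; have [rr ri] := rphi.
apply: (gauss_class_schwartz s0).
- rewrite (_ : (fun k => _) = (fun k =>
    c3 * (gauss s k * trig_transform (fun x => Re (phi x)) 0 k)
    + (- c3) * (gauss s k * trig_transform (fun x => Im (phi x)) (- (pi / 2)) k))).
    by apply: gauss_class_add; apply: gauss_class_scale; exact: gauss_class_base.
  by apply/funext => k; rewrite ReRM Re_inv_fourier//; ring.
- rewrite (_ : (fun k => _) = (fun k =>
    c3 * (gauss s k * trig_transform (fun x => Re (phi x)) (- (pi / 2)) k)
    + c3 * (gauss s k * trig_transform (fun x => Im (phi x)) 0 k))).
    by apply: gauss_class_add; apply: gauss_class_scale; exact: gauss_class_base.
  by apply/funext => k; rewrite ImRM Im_inv_fourier//; ring.
Qed.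

Lemma measurable_dot2 : measurable_fun setT (fun z : R3 R * R3 R => dot z.1 z.2).
Proof.
rewrite (_ : (fun z => _) = (fun z => z.1.1.1 * z.2.1.1 + z.1.1.2 * z.2.1.2 + z.1.2 *
  z.2.2));
  last by apply/funext => z; rewrite dotE.
have m i := @measurable_coord R i.
have m1 i : measurable_fun setT (fun z : R3 R * R3 R => coord i z.1).
  by apply: (measurableT_comp (m i)); exact: measurable_fst.
have m2 i : measurable_fun setT (fun z : R3 R * R3 R => coord i z.2).
  by apply: (measurableT_comp (m i)); exact: measurable_snd.
apply: measurable_funD; [apply: measurable_funD|]; apply: measurable_funM;
  by [exact: (m1 ord0)|exact: (m2 ord0)|exact: (m1 (lift ord0 ord0))
     |exact: (m2 (lift ord0 ord0))|exact: (m1 (lift ord0 (lift ord0 ord0)))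
     |exact: (m2 (lift ord0 (lift ord0 ord0)))].
Qed.

Lemma sqnorm_ge0 x : 0 <= sqnorm x.
Proof. by rewrite sqnormE !addr_ge0// sqr_ge0. Qed.

Lemma rapid_heat (s : R) h y : 0 < s -> rapid h ->
  rapid (fun x => h x * expR (- (sqnorm (x - y) / (4 * s)))).
Proof.
move=> s0 rh; apply: (@rapidM_bounded _ _ _ 1 rh).
  apply: continuous_measurable3 => x.
  apply: (@continuous_comp _ _ _ (fun x => - (sqnorm (x - y) / (4 * s))) expR);
    last exact: continuous_expR.
  apply: cvgN; apply: cvgM; last exact: cvg_cst.
  apply: (@continuous_comp _ _ _ (fun x => x - y) (@sqnorm R));
    last exact: continuous_sqnorm.
  by apply: cvgB; [exact: cvg_id|exact: cvg_cst].
move=> x; rewrite gtr0_norm ?expR_gt0// expR_le1 oppr_le0 divr_ge0 ?sqnorm_ge0//.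
by rewrite mulr_ge0// ltW.
Qed.

(** Used with [d = dot k y]: read from right to left, it absorbs the kernel of an outer Fourier
    integral into the phase of the inner one. *)
Lemma trig_transform_phaseB h c d k : rapid h -> trig_transform h (c - d) k =
  trig_transform h c k * cos d + trig_transform h (c - pi / 2) k * sin d.
Proof.
move=> rh; have i e := rapid_integrable (rapid_cos k e rh).
rewrite /trig_transform -!RintegralZr// -RintegralD//; last 2 first.
- by have := integrableZr measurableT (cos d) (i c); congr (_.-integrable _ _).
- by have := integrableZr measurableT (sin d) (i (c - pi / 2)); congr (_.-integrable _ _).
by apply: eq_Rintegral => x _; rewrite !addrA cosB cos_shift; ring.
Qed.

Lemma trig_transform_Npi h k : rapid h ->
  trig_transform h (- (pi / 2) - pi / 2) k = - trig_transform h 0 k.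
Proof.
move=> rh; rewrite /trig_transform -[RHS]mulN1r -RintegralZl//;
  last exact: rapid_integrable (rapid_cos k 0 rh).
apply: eq_Rintegral => x _.
by rewrite addrA cos_shift sinB cos_pihalf sin_pihalf addr0; ring.
Qed.

(** The phase varies with [k], so the integrand is not a base case of [gauss_class]; splitting the
    phase writes it as two such members times bounded cosines. *)
Lemma integrable_gauss_trig_transform (s c : R) h y : 0 < s -> rapid h ->
  (leb3 R).-integrable setT
    (EFin \o (fun k => gauss s k * trig_transform h (c - dot k y) k)).
Proof.
move=> s0 rh.
have r d e : rapid (fun k => gauss s k * trig_transform h d k * cos (dot y k + e)).
  by apply: rapid_cos; apply: (gauss_class_rapid s0); exact: gauss_class_base.
have := rapid_integrable (rapidD (r c 0) (r (c - pi / 2) (- (pi / 2)))).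
congr (_.-integrable _ _); apply/funext => k /=.
by rewrite (trig_transform_phaseB c (dot k y))// (dotC y) addr0 cos_shift;
  congr EFin; ring.
Qed.

(** After exchanging the integrals the phases combine to [dot (x - y) k + c], so the inner integral
    is the transform of a Gaussian at [x - y]. *)
Lemma Rintegral_gauss_trig_transform (s c : R) h y : 0 < s -> rapid h ->
  \int[leb3 R]_k (gauss s k * trig_transform h (c - dot k y) k) =
  cos c * Num.sqrt (pi / s) ^+ 3 *
    \int[leb3 R]_x (h x * expR (- (sqnorm (x - y) / (4 * s)))).
Proof.
move=> s0 rh; have rg := rapid_gauss s0.
pose Q k x := gauss s k * (h x * cos (dot k x + (c - dot k y))).
have phase k x : dot k x + (c - dot k y) = dot (x - y) k + c.
  by rewrite dotDl dotNl !(dotC _ k); ring.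
have mQ : measurable_fun setT (fun z : R3 R * R3 R => Q z.1 z.2).
  rewrite /Q; apply: measurable_funM; first exact: (measurableT_comp rg.1 measurable_fst).
  apply: measurable_funM; first exact: (measurableT_comp rh.1 measurable_snd).
  apply: (measurableT_comp (f := cos)).
    by apply: continuous_measurable_fun; exact: continuous_cos.
  apply: measurable_funD; first exact: measurable_dot2.
  apply: measurable_funB => //.
  apply: (measurableT_comp (f := fun k => dot k y)); last exact: measurable_fst.
  by rewrite (_ : (fun k => _) = dot y); [exact: measurable_dot|apply/funext => k;
    exact: dotC].
(* The cosine is bounded by 1, which leaves the tensor product of two integrable functions. *)
have iQ : (@leb3_sf R \x @leb3_sf R)%E.-integrable setT (fun z => (Q z.1 z.2)%:E).
  have ih : (@leb3_sf R).-integrable setT (EFin \o (fun x => `|h x|)).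
    exact: (integrable_abse (rapid_integrable rh)).
  have ig : (@leb3_sf R).-integrable setT (EFin \o gauss s) := rapid_integrable rg.
  apply: (@integrable_bounded _ _ R (@leb3_sf R \x @leb3_sf R)%E (fun z =>
    Q z.1 z.2) (fun z => gauss s z.1 * `|h z.2|) mQ).
    move=> z; rewrite /Q normrM (gtr0_norm (expR_gt0 _)) ler_pM2l ?expR_gt0//.
    by rewrite normrM ler_piMr ?norm_cos_le1.
  exact: (integrable_tensor ig ih).
have i1 k : (@leb3_sf R).-integrable setT (EFin \o Q k).
  exact: rapid_integrable (rapidZ (gauss s k) (rapid_cos k (c - dot k y) rh)).
have rg2 x := rapid_cos (x - y) c rg.
have i2 x : (@leb3_sf R).-integrable setT (EFin \o Q ^~ x).
  have := rapid_integrable (rapidZ (h x) (rg2 x)).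
  congr (_.-integrable _ _); apply/funext => k /=; rewrite /Q phase; congr EFin; ring.
transitivity (\int[@leb3_sf R]_k \int[@leb3_sf R]_x Q k x).
  apply: eq_Rintegral => k _; rewrite RintegralZl//.
  exact: rapid_integrable (rapid_cos k (c - dot k y) rh).
rewrite (Rintegral_fubini iQ i1 i2).
rewrite -RintegralZl//; last exact: rapid_integrable (rapid_heat _ s0 rh).
apply: eq_Rintegral => x _.
transitivity (h x * trig_transform (gauss s) c (x - y)).
  rewrite /trig_transform -RintegralZl//; last exact: rapid_integrable (rg2 x).
  by apply: eq_Rintegral => k _; rewrite /Q phase; ring.
by rewrite trig_transform_gauss//; ring.
Qed.

(** [Re phi] enters with phase [0] and [Im phi] with phase [- (pi / 2)]; the factor [cos c] of the
    Gaussian integral removes the second. *)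
Lemma Re_fourier_gauss (s : R) phi y : 0 < s -> crapid phi ->
  Re (fourier (fun k => (gauss s k)%:C * inv_fourier phi k) y) =
  c3 * Num.sqrt (pi / s) ^+ 3 *
    \int[leb3 R]_x (Re (phi x) * expR (- (sqnorm (x - y) / (4 * s)))).
Proof.
move=> s0 rphi; have [rr ri] := rphi.
have iA c h (rh : rapid h) := integrable_gauss_trig_transform c y s0 rh.
rewrite -[LHS]/(\int[leb3 R]_k Re (_ * _ * cexpi (- dot y k))).
transitivity (\int[leb3 R]_k (c3 *
    (gauss s k * trig_transform (fun x => Re (phi x)) (0 - dot k y) k -
     gauss s k * trig_transform (fun x => Im (phi x)) (- (pi / 2) - dot k y) k))).
  apply: eq_Rintegral => k _.
  rewrite ReM ReRM ImRM Re_inv_fourier// Im_inv_fourier// !(trig_transform_phaseB _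
    (dot k y))//=.
  by rewrite cosN sinN (dotC y) sub0r trig_transform_Npi//; ring.
rewrite RintegralZl//; last first.
  by have := integrableB measurableT (iA 0 _ rr) (iA (- (pi / 2)) _ ri);
    congr (_.-integrable _ _).
rewrite RintegralB//; [|exact: iA|exact: iA].
by rewrite !Rintegral_gauss_trig_transform// cos0 cosN cos_pihalf; ring.
Qed.

Lemma Im_fourier_gauss (s : R) phi y : 0 < s -> crapid phi ->
  Im (fourier (fun k => (gauss s k)%:C * inv_fourier phi k) y) =
  c3 * Num.sqrt (pi / s) ^+ 3 *
    \int[leb3 R]_x (Im (phi x) * expR (- (sqnorm (x - y) / (4 * s)))).
Proof.
move=> s0 rphi; have [rr ri] := rphi.
have iA c h (rh : rapid h) := integrable_gauss_trig_transform c y s0 rh.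
rewrite -[LHS]/(\int[leb3 R]_k Im (_ * _ * cexpi (- dot y k))).
transitivity (\int[leb3 R]_k (c3 *
    (gauss s k * trig_transform (fun x => Re (phi x)) (- (pi / 2) - dot k y) k +
     gauss s k * trig_transform (fun x => Im (phi x)) (0 - dot k y) k))).
  apply: eq_Rintegral => k _.
  rewrite ImM ReRM ImRM Re_inv_fourier// Im_inv_fourier// !(trig_transform_phaseB _
    (dot k y))//=.
  by rewrite cosN sinN (dotC y) sub0r trig_transform_Npi//; ring.
rewrite RintegralZl//; last first.
  by have := integrableD measurableT (iA (- (pi / 2)) _ rr) (iA 0 _ ri);
    congr (_.-integrable _ _).
rewrite RintegralD//; [|exact: iA|exact: iA].
by rewrite !Rintegral_gauss_trig_transform// cos0 cosN cos_pihalf; ring.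
Qed.

Lemma fourier_gauss_conv (l : R) phi : 0 < l -> crapid phi ->
  fourier (fun k => (gauss (l ^+ 2) k)%:C * inv_fourier phi k) =
  conv (fun x => gaussian l (- x)) phi.
Proof.
move=> l0 rphi; have [rr ri] := rphi; apply/funext => y.
have s0 : 0 < l ^+ 2 by rewrite exprn_gt0.
(* The factor [(2 pi)^-3] of the inverse transform times the mass of [gauss (l ^+ 2)] is the
   normalisation of [gaussian l]. *)
have K : c3 * Num.sqrt (pi / l ^+ 2) ^+ 3 = ((2 * l * Num.sqrt pi) ^+ 3)^-1.
  rewrite /c3 sqrtrM ?pi_ge0// sqrtrV ?ltW// sqrtr_sqr gtr0_norm//.
  have p0 : Num.sqrt pi != 0 :> R by rewrite sqrtr_eq0 -ltNge pi_gt0.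
  rewrite -[X in (2 * X)](sqr_sqrtr (pi_ge0 R)).
  by field; rewrite p0 gt_eqF.
apply: complex_ext.
- rewrite Re_fourier_gauss// K /conv /= -RintegralZl//;
  last exact: rapid_integrable (rapid_heat _ s0 rr).
  by apply: eq_Rintegral => x _; rewrite ReRM opprB; ring.
- rewrite Im_fourier_gauss// K /conv /= -RintegralZl//;
  last exact: rapid_integrable (rapid_heat _ s0 ri).
  by apply: eq_Rintegral => x _; rewrite ImRM opprB; ring.
Qed.

(** The minus signs of two integrations by parts cancel; the remaining one is the phase shift by
    [pi]. *)
Lemma trig_transform_partial2 i h h1 h2 c k :
  rapid h -> rapid h1 -> rapid h2 ->
  continuous h -> continuous h1 -> continuous h2 ->
  (forall x, is_derive x (basis R i) h (h1 x)) ->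
  (forall x, is_derive x (basis R i) h1 (h2 x)) ->
  trig_transform h2 c k = - coord i k ^+ 2 * trig_transform h c k.
Proof.
move=> r r1 r2 ch ch1 ch2 dh dh1.
rewrite (trig_transform_partial c k r1 r2 ch1 ch2 dh1).
rewrite (trig_transform_partial _ k r r1 ch ch1 dh).
rewrite (_ : trig_transform h (c + pi / 2 + pi / 2) k = - trig_transform h c k);
  first by ring.
rewrite /trig_transform -[RHS]mulN1r -RintegralZl//;
  last exact: rapid_integrable (rapid_cos k c r).
by apply: eq_Rintegral => x _; rewrite !addrA !cosDpihalf sinDpihalf; ring.
Qed.

Lemma trig_transform_sum h0 h1 h2 c k : rapid h0 -> rapid h1 -> rapid h2 ->
  trig_transform (fun x => h0 x + h1 x + h2 x) c k =
  trig_transform h0 c k + trig_transform h1 c k + trig_transform h2 c k.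
Proof.
move=> r0 r1 r2; have i h (r : rapid h) := rapid_integrable (rapid_cos k c r).
rewrite /trig_transform -RintegralD; [|by []|exact: i|exact: i].
rewrite -RintegralD; [|by []| |exact: i]; last first.
  exact: rapid_integrable (rapidD (rapid_cos k c r0) (rapid_cos k c r1)).
by apply: eq_Rintegral => x _; ring.
Qed.

(** Expresses the Laplacian by [partials], the form in which smoothness and decay of Schwartz
    functions are given. *)
Lemma laplacianE phi x : laplacian phi x =
  partials [:: ord0; ord0] phi x +
  partials [:: lift ord0 ord0; lift ord0 ord0] phi x +
  partials [:: lift ord0 (lift ord0 ord0); lift ord0 (lift ord0 ord0)] phi x.
Proof.
have E (a b c : R[i]) : a + (b + (c + 0)) = a + b + c by rewrite addr0 addrA.
by rewrite /laplacian !big_ord_recl big_ord0; exact: E.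
Qed.

Lemma crapid_laplacian phi : schwartz phi -> crapid (laplacian phi).
Proof.
move=> sphi; have r i := schwartz_crapid [:: i; i] sphi; split.
- rewrite (_ : (fun x => _) = (fun x => Re (partials [:: ord0; ord0] phi x) +
    Re (partials [:: lift ord0 ord0; lift ord0 ord0] phi x) +
    Re (partials [:: lift ord0 (lift ord0 ord0); lift ord0 (lift ord0 ord0)] phi x))).
    by apply: rapidD; [apply: rapidD|]; exact: (r _).1.
  by apply/funext => x; rewrite laplacianE !ReD.
- rewrite (_ : (fun x => _) = (fun x => Im (partials [:: ord0; ord0] phi x) +
    Im (partials [:: lift ord0 ord0; lift ord0 ord0] phi x) +
    Im (partials [:: lift ord0 (lift ord0 ord0); lift ord0 (lift ord0 ord0)] phi x))).
    by apply: rapidD; [apply: rapidD|]; exact: (r _).2.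
  by apply/funext => x; rewrite laplacianE !ImD.
Qed.

Lemma trig_transform_laplacian_Re phi c k : schwartz phi ->
  trig_transform (fun x => Re (laplacian phi x)) c k =
  - sqnorm k * trig_transform (fun x => Re (phi x)) c k.
Proof.
move=> sphi; have r t := (schwartz_crapid t sphi).1.
have ct t : continuous (fun x => Re (partials t phi x)) by have [] := sphi.1 t.
have dt t i x : is_derive x (basis R i) (fun x =>
  Re (partials t phi x)) (Re (partials (i :: t) phi x)).
  by have [_ _ /(_ i x)[d _]] := sphi.1 t; split.
set u := trig_transform (fun x => Re (phi x)) c k.
have E i : trig_transform (fun x => Re (partials [:: i;
  i] phi x)) c k = - coord i k ^+ 2 * u.
  exact: (trig_transform_partial2 c k (r [::]) (r [:: i]) (r [:: i; i])
    (ct [::]) (ct [:: i]) (ct [:: i; i]) (dt [::] i) (dt [:: i] i)).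
under [in LHS]eq_fun do rewrite laplacianE !ReD.
rewrite trig_transform_sum; [|exact: r..].
rewrite [X in X + _ + _](E ord0) [X in _ + X + _](E (lift ord0 ord0)).
rewrite [X in _ + X](E (lift ord0 (lift ord0 ord0))).
by rewrite -!mulrDl sqnormE !opprD.
Qed.

Lemma trig_transform_laplacian_Im phi c k : schwartz phi ->
  trig_transform (fun x => Im (laplacian phi x)) c k =
  - sqnorm k * trig_transform (fun x => Im (phi x)) c k.
Proof.
move=> sphi; have r t := (schwartz_crapid t sphi).2.
have ct t : continuous (fun x => Im (partials t phi x)) by have [] := sphi.1 t.
have dt t i x : is_derive x (basis R i) (fun x =>
  Im (partials t phi x)) (Im (partials (i :: t) phi x)).
  by have [_ _ /(_ i x)[_ d]] := sphi.1 t; split.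
set u := trig_transform (fun x => Im (phi x)) c k.
have E i : trig_transform (fun x => Im (partials [:: i;
  i] phi x)) c k = - coord i k ^+ 2 * u.
  exact: (trig_transform_partial2 c k (r [::]) (r [:: i]) (r [:: i; i])
    (ct [::]) (ct [:: i]) (ct [:: i; i]) (dt [::] i) (dt [:: i] i)).
under [in LHS]eq_fun do rewrite laplacianE !ImD.
rewrite trig_transform_sum; [|exact: r..].
rewrite [X in X + _ + _](E ord0) [X in _ + X + _](E (lift ord0 ord0)).
rewrite [X in _ + X](E (lift ord0 (lift ord0 ord0))).
by rewrite -!mulrDl sqnormE !opprD.
Qed.

Lemma inv_fourier_laplacian phi k : schwartz phi ->
  inv_fourier (laplacian phi) k = (- sqnorm k)%:C * inv_fourier phi k.
Proof.
move=> sphi; have rl := crapid_laplacian sphi.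
have rphi := schwartz_crapid [::] sphi.
apply: complex_ext.
- rewrite [RHS]ReRM !Re_inv_fourier// trig_transform_laplacian_Re//.
  by rewrite trig_transform_laplacian_Im//; ring.
- rewrite [RHS]ImRM !Im_inv_fourier// trig_transform_laplacian_Re//.
  by rewrite trig_transform_laplacian_Im//; ring.
Qed.

End FourierGauss.

(** * Integrability of the weight *)

(** Inversion is discontinuous at [0]; on nonnegative reals it agrees with the real power of
    exponent [-1], also at [0], where both give [0]. *)
Lemma measurable_funV_ge0 d (T : measurableType d) (R : realType) (f : T -> R) :
  (forall x, 0 <= f x) -> measurable_fun setT f ->
  measurable_fun setT (fun x => (f x)^-1).
Proof.
move=> f0 mf; rewrite (_ : (fun x => _) = (fun x => f x `^ (-1))).
  by apply: (measurableT_comp (f := fun r : R => r `^ (-1)));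
    first exact: measurable_powR.
by apply/funext => x; rewrite powR_inv1.
Qed.

Section NewtonPotential.
Context {R : realType}.
Local Notation mu := (@lebesgue_measure R).
Implicit Types (s q : R) (k : R3 R).

Lemma integral_expR_ray s q : 0 < q ->
  (\int[mu]_(t in `[s, +oo[) (expR (- (t * q)))%:E = (expR (- (s * q)) / q)%:E)%E.
Proof.
move=> q0; have qn0 : q != 0 by rewrite gt_eqF.
have ce : continuous (fun t : R => expR (- (t * q))).
  move=> t; apply: (@continuous_comp _ _ _ (fun t : R => - (t * q)) expR).
    by apply: cvgN; apply: cvgM; [exact: cvg_id|exact: cvg_cst].
  exact: continuous_expR.
pose F (t : R) := - q^-1 * expR (- (t * q)).
have dF t : is_derive t (1 : R) F (expR (- (t * q))).
  have D : is_derive t (1 : R) (fun t : R => - (t * q)) (- q).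
    by apply: is_derive_eq; rewrite -![_ *: _]/(_ * _); ring.
  apply: is_derive_eq (is_deriveZ (- q^-1) (@is_derive1_comp R expR _ _ _ _
    (is_derive_expR _) D)) _.
  by rewrite -![_ *: _]/(_ * _); field.
rewrite (@ge0_continuous_FTC2y R (fun t => expR (- (t * q))) F s 0).
- by congr EFin; rewrite /F; field.
- by move=> t _; exact: expR_ge0.
- exact: continuous_subspaceT.
- rewrite /F -[X in _ --> X](mulr0 (- q^-1)); apply: cvgM; first exact: cvg_cst.
  apply: (cvg_comp (fun t => t * q) (fun y => expR (- y))); last exact: cvgr_expR.
  by apply: gt0_cvgMly => //; exact: cvg_id.
- by move=> t _; have [] := dF t.
- apply: cvg_at_right_filter; apply: cvgM; first exact: cvg_cst.
  exact: ce.
- by move=> t _; rewrite derive1E; have [] := dF t.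
Qed.

Lemma integral_sqrtV3_ray s : 0 < s ->
  (\int[mu]_(t in `[s, +oo[) ((Num.sqrt t)^-1 ^+ 3)%:E < +oo)%E.
Proof.
move=> s0.
(* A primitive of [t^(-3/2)] that vanishes at infinity. *)
pose F (t : R) := - 2 * (Num.sqrt t)^-1.
have sq0 t : s <= t -> Num.sqrt t != 0.
  by move=> st; rewrite sqrtr_eq0 -ltNge (lt_le_trans s0).
have cs t : s <= t -> {for t, continuous (fun t : R => (Num.sqrt t)^-1)}.
  by move=> st; apply: cvgV; [exact: sq0|exact: sqrt_continuous].
have cs3 t : s <= t -> {for t, continuous (fun t : R => (Num.sqrt t)^-1 ^+ 3)}.
  move=> st; apply: (@continuous_comp _ _ _ (fun t : R => (Num.sqrt t)^-1) (fun x =>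
    x ^+ 3)).
    exact: cs.
  exact: exprn_continuous.
have dF t : s < t -> is_derive t (1 : R) F ((Num.sqrt t)^-1 ^+ 3).
  move=> st; have t0 := lt_trans s0 st.
  have D := is_derive1_sqrt t0.
  apply: is_derive_eq (is_deriveZ (- 2) (is_deriveV (sq0 t (ltW st)) D)) _.
  by rewrite -![_ *: _]/(_ * _); have := sq0 t (ltW st); move: (Num.sqrt t) => u u0;
    field.
rewrite (@ge0_continuous_FTC2y R (fun t => (Num.sqrt t)^-1 ^+ 3) F s 0).
- exact: ltry.
- by move=> t _; rewrite exprn_ge0// invr_ge0.
- apply/continuous_within_itvcyP; split => [t|].
    by rewrite in_itv/= andbT => /ltW st; exact: cs3.
  by apply: cvg_at_right_filter; exact: cs3.
- rewrite /F -[X in _ --> X](mulr0 (- 2)); apply: cvgM; first exact: cvg_cst.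
  apply/cvgr0Pnorm_le => e e0; near=> t.
  have t0 : 0 < t by near: t; exact: nbhs_pinfty_gt.
  rewrite normfV ger0_norm ?sqrtr_ge0// invf_ple ?posrE ?sqrtr_gt0//.
  rewrite -[leLHS]gtr0_norm ?invr_gt0// -sqrtr_sqr ler_sqrt; last exact: ltW.
  by near: t; apply: nbhs_pinfty_ge; exact: num_real.
- by move=> t st; have [] := dF t st.
- apply: cvg_at_right_filter; apply: cvgM; first exact: cvg_cst.
  exact: cs.
- by move=> t; rewrite in_itv/= andbT => st; rewrite derive1E; have [] := dF t st.
Unshelve. all: by end_near. Qed.

Lemma measurable_gauss_sqnormV s : measurable_fun setT (fun k => gauss s k / sqnorm k).
Proof.
apply: measurable_funM; first by apply: continuous_measurable3; exact: continuous_gauss.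
apply: measurable_funV_ge0; first exact: sqnorm_ge0.
by apply: continuous_measurable3; exact: continuous_sqnorm.
Qed.

Lemma gauss_sqnormV_ge0 s k : 0 <= gauss s k / sqnorm k.
Proof. by rewrite divr_ge0 ?sqnorm_ge0// expR_ge0. Qed.

(* [exp(- s |k|^2) / |k|^2] is the integral of the Gaussians [exp(- t |k|^2)]
   over [t >= s] (an upper bound at [k = 0], where the quotient is [0]), so that
   Tonelli reduces integrability to that of [t^(-3/2)] at infinity. *)
Lemma integrable_gauss_sqnormV s : 0 < s ->
  (leb3 R).-integrable setT (EFin \o (fun k => gauss s k / sqnorm k)).
Proof.
move=> s0; apply/integrableP; split.
  by apply/measurable_EFinP; exact: measurable_gauss_sqnormV.
(* The indicator extends the integral over the ray to the whole line, the setting of Tonelli. *)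
pose G (z : R3 R * R) : R := expR (- (z.2 * sqnorm z.1)) * \1_(`[s, +oo[%classic) z.2.
have G0 z : 0 <= G z by rewrite mulr_ge0 ?expR_ge0.
have mG : measurable_fun setT G.
  apply: measurable_funM.
    apply: (measurableT_comp (f := expR)).
      by apply: continuous_measurable_fun; exact: continuous_expR.
    apply: measurable_funN; apply: measurable_funM; first exact: measurable_snd.
    apply: (measurableT_comp (f := @sqnorm R)); last exact: measurable_fst.
    by apply: continuous_measurable3; exact: continuous_sqnorm.
  apply: (measurableT_comp (f := (\1_(`[s, +oo[%classic) : R -> R)));
    last exact: measurable_snd.
  exact: measurable_indic.
have innerE k : (\int[mu]_t (G (k, t))%:E = \int[mu]_(t in `[s,
  +oo[) (expR (- (t * sqnorm k)))%:E)%E.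
  rewrite [RHS]integral_mkcond; apply: eq_integral => t _.
  by rewrite patchE /G /= indicE; case: ifPn => _; rewrite ?mulr1 ?mulr0.
apply: (@le_lt_trans _ _ (\int[@leb3_sf R]_k \int[mu]_t (G (k, t))%:E)%E).
  apply: ge0_le_integral => //.
  - apply/measurable_EFinP; apply: measurableT_comp => //;
    exact: measurable_gauss_sqnormV.
  - apply: (@measurable_fun_fubini_tonelli_F _ _ _ _ R mu (EFin \o G)).
      exact/measurable_EFinP.
    by move=> z; rewrite lee_fin.
  move=> k _; rewrite /= ger0_norm ?gauss_sqnormV_ge0// innerE.
  have := sqnorm_ge0 k; rewrite le_eqVlt => /orP[/eqP <-|k0].
    by rewrite invr0 mulr0; apply: integral_ge0 => t _; rewrite lee_fin expR_ge0.
  by rewrite integral_expR_ray.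
have mEG : measurable_fun setT (EFin \o G) by exact/measurable_EFinP.
rewrite (@fubini_tonelli _ _ _ _ R (@leb3_sf R) mu (EFin \o G) mEG); last first.
  by move=> z; rewrite lee_fin.
have E : (\int[mu]_t \int[@leb3_sf R]_k (EFin \o G) (k, t) =
    \int[mu]_(t in `[s, +oo[) (Num.sqrt pi ^+ 3 * (Num.sqrt t)^-1 ^+ 3)%:E)%E.
  rewrite [RHS]integral_mkcond; apply: eq_integral => t _.
  rewrite patchE /G /=; case: ifPn => st; last first.
    by apply: integral0_eq => k _; rewrite indicE (negbTE st) mulr0.
  have t0 : 0 < t.
    by move: st; rewrite inE/= in_itv/= andbT; exact: lt_le_trans.
  rewrite -exprMn -sqrtrV ?ltW// -sqrtrM ?pi_ge0// -(integral_gauss t0).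
  by apply: eq_integral => k _; rewrite indicE st mulr1.
rewrite E; under eq_integral do rewrite EFinM.
rewrite ge0_integralZl_EFin//.
- by rewrite lte_mul_pinfty ?lee_fin ?exprn_ge0//; exact: integral_sqrtV3_ray.
- apply/measurable_EFinP; apply: measurable_funTS; apply: measurable_funX.
  apply: measurable_funV_ge0; first exact: sqrtr_ge0.
  by apply: continuous_measurable_fun; exact: sqrt_continuous.
Qed.

End NewtonPotential.

(** * Lebesgue measurable functions *)

Section NullSets.
Context d {T : measurableType d} {R : realType} (mu : {measure set T -> \bar R}).
Local Open Scope ereal_scope.
Import HBNNSimple.

(** Valid for arbitrary nonnegative functions, since the integral is a supremum over simple
    functions below the integrand: such a function for [f], set to zero on [N], lies below [g] and
    keeps its integral. This handles integrands that are only Lebesgue measurable. *)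
Lemma ge0_le_integral_off_null (N : set T) (f g : T -> \bar R) :
  measurable N -> mu N = 0 ->
  (forall x, 0 <= f x) -> (forall x, 0 <= g x) ->
  (forall x, ~ N x -> f x = g x) -> \int[mu]_x f x <= \int[mu]_x g x.
Proof.
move=> mN N0 f0 g0 fg; rewrite (ge0_integralTE _ f0) (ge0_integralTE _ g0).
apply: ge_ereal_sup => _ [h /= hf <-].
pose h' : {nnsfun T >-> R} := proj_nnsfun h (measurableC mN).
apply: (@le_trans _ _ (sintegral mu h')); last first.
  apply: ereal_sup_ubound; exists h' => // x;
    rewrite -[leLHS]/((h x * \1_(~` N) x)%R%:E) indicE.
  have [Nx|Nx] := pselect (N x).
    by rewrite memNset ?mulr0//= => /(_ Nx).
  by rewrite mem_set// mulr1 -fg.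
rewrite -!integralT_nnsfun (@ge0_ae_eq_integral _ _ _ mu setT (EFin \o h) (EFin \o h'))//.
- by apply/measurable_EFinP.
- by apply/measurable_EFinP.
- by move=> x _; rewrite lee_fin.
- by move=> x _; rewrite lee_fin.
- exists N; split => // x /= H; apply: contrapT => Nx; apply: H => _.
  by rewrite -[RHS]/((h x * \1_(~` N) x)%R%:E) indicE mem_set// mulr1.
Qed.

Lemma integral_off_null (N : set T) (f g : T -> \bar R) :
  measurable N -> mu N = 0 -> (forall x, ~ N x -> f x = g x) ->
  \int[mu]_x f x = \int[mu]_x g x.
Proof.
move=> mN N0 fg; rewrite integralE [RHS]integralE; congr (_ - _).
- by apply/eqP; rewrite eq_le; apply/andP; split;
  apply: (ge0_le_integral_off_null mN N0) => // x Nx;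
    rewrite !funeposE fg.
- by apply/eqP; rewrite eq_le; apply/andP; split;
  apply: (ge0_le_integral_off_null mN N0) => // x Nx;
    rewrite !funenegE fg.
Qed.

(** For each rational [q] the set where [f > q] is Borel up to a null set; the union [N] of these
    countably many null sets is null, and off [N] all the level sets are Borel at once. *)
Lemma completed_measurable_borel (f : T -> R) :
  (forall B : set R, measurable B -> completed_algebra_gen mu (f @^-1` B)) ->
  exists N, [/\ measurable N, mu N = 0 & measurable_fun setT (fun x =>
    (f x * \1_(~` N) x)%R)].
Proof.
move=> mf.
have /choice[AM hAM] : forall q : rat, exists AM : set T * set T,
    [/\ measurable AM.1, measurable AM.2, mu AM.2 = 0 &
        forall x, ~ AM.2 x -> (f x > ratr q)%R <-> AM.1 x].
  move=> q; have [A mA [N0 [M [mM M0 NM]] AN]] := mf _ (measurable_itv `]ratr q, +oo[).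
  exists (A, M); split => // x /= Mx.
  have -> : (f x > ratr q)%R <-> (A `|` N0) x by rewrite AN /= in_itv/= andbT.
  by split => [[//|/NM]//|]; left.
pose N := \bigcup_n (if unpickle n is Some q then (AM q).2 else set0).
have mNn n : measurable (if unpickle n is Some q then (AM q).2 else set0).
  by case: unpickle => [q|//]; have [] := hAM q.
have mN : measurable N by exact: bigcupT_measurable.
have N0 : mu N = 0.
  apply: measure_negligible => //; apply: negligible_bigcup => n.
  case: unpickle => [q|]; last exact: negligible_set0.
  by have [_ mM M0 _] := hAM q; apply/negligibleP.
have NA q x : ~ N x -> (f x > ratr q)%R <-> (AM q).1 x.
  move=> Nx; have [_ _ _] := hAM q; apply => Mx; apply: Nx.
  by exists (pickle q); [exact: Logic.I|rewrite pickleK].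
exists N; split => //; apply: (measurability _ (RGenOInfty.measurableE R)).
move=> /= _ [_ [a ->] <-]; rewrite setTI.
(* A real level [a] is approached by rationals above it. On [N] the modified function is [0], so [N]
   belongs to the set exactly when [a < 0]. *)
rewrite (_ : _ @^-1` _ = (\bigcup_(q : rat) (if (a < ratr q)%R then (AM q).1 `\` N
  else set0))
   `|` (if (a < 0)%R then N else set0)).
  apply: measurableU; last by case: ifP.
  apply: countable_bigcupT_measurable => [|q]; first exact: countableP.
  by case: ifP => // _; apply: measurableD => //; have [] := hAM q.
apply/seteqP; split => x; rewrite /= in_itv/= andbT indicE.
- have [Nx|Nx] := pselect (N x).
    by rewrite memNset ?mulr0; [move=> a0; right; rewrite a0|move=> /(_ Nx)].
  rewrite mem_set// mulr1 => /rat_in_itvoo[q]; rewrite in_itv/= => /andP[aq qf].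
  by left; exists q => //; rewrite aq; split => //; exact/NA.
- case=> [[q _]|].
    case: ifP => // aq [Aq Nx]; rewrite mem_set// mulr1 (lt_trans aq)//.
    exact/(NA q x Nx).
  by case: ifP => // a0 Nx; rewrite memNset ?mulr0// => /(_ Nx).
Qed.

End NullSets.

Section LebesgueMeasurable.
Context {R : realType}.
Implicit Types (f u v : R3 R -> R[i]) (N : set (R3 R)).

Definition cmeasurable f :=
  measurable_fun setT (fun x => Re (f x)) /\
  measurable_fun setT (fun x => Im (f x)).

Definition cintegrable f :=
  (leb3 R).-integrable setT (fun x => (Re (f x))%:E) /\
  (leb3 R).-integrable setT (fun x => (Im (f x))%:E).

Definition off_null f g := exists N, [/\ measurable N, leb3 R N = 0%E &
  forall x, ~ N x -> f x = g x].

Lemma lebesgue_measurable_borel f : lebesgue_measurable f ->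
  exists N, [/\ measurable N, leb3 R N = 0%E &
    cmeasurable (fun x => (\1_(~` N) x)%:C * f x)].
Proof.
move=> mf.
have [|N1 [mN1 N10 m1]] := @completed_measurable_borel _ _ _ (leb3 R) (fun x => Re (f x)).
  by move=> B mB; have [] := mf B mB.
have [|N2 [mN2 N20 m2]] := @completed_measurable_borel _ _ _ (leb3 R) (fun x => Im (f x)).
  by move=> B mB; have [] := mf B mB.
have mN : measurable (N1 `|` N2) by exact: measurableU.
exists (N1 `|` N2); split => //.
  by apply: measure_negligible => //; apply: negligibleU; apply/negligibleP.
have E x : \1_(~` (N1 `|` N2)) x = \1_(~` N1) x * \1_(~` N2) x :> R.
  by rewrite setCU indicI.
have mi N : measurable N -> measurable_fun setT (\1_(~` N) : R3 R -> R).
  by move=> mN'; apply: measurable_indic; exact: measurableC.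
split.
- rewrite (_ : (fun x => _) = (fun x => (Re (f x) * \1_(~` N1) x) * \1_(~` N2) x)).
    by apply: measurable_funM => //; exact: mi.
  by apply/funext => x; rewrite ReRM E; ring.
- rewrite (_ : (fun x => _) = (fun x => (Im (f x) * \1_(~` N2) x) * \1_(~` N1) x)).
    by apply: measurable_funM => //; exact: mi.
  by apply/funext => x; rewrite ImRM E; ring.
Qed.

(** The preimage under [f] is a Borel set outside [N] together with some subset of [N]. This is the
    way back from a Borel representative to the weight itself. *)
Lemma off_null_lebesgue_measurable f g : cmeasurable g -> off_null f g ->
  lebesgue_measurable f.
Proof.
move=> [mr mi] [N [mN N0 fg]] B mB.
have H (a b : R3 R -> R) : measurable_fun setT b -> (forall x, ~ N x -> a x = b x) ->
    completed_algebra_gen (leb3 R) (a @^-1` B).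
  move=> mb ab; exists ((b @^-1` B) `\` N).
    by apply: measurableD => //; rewrite -[X in measurable X]setTI; exact: mb.
  exists ((a @^-1` B) `&` N); first by exists N; split => // x [].
  apply/seteqP; split => x /=.
    by case=> [[bx Nx]|[]//]; rewrite ab.
  by move=> ax; have [Nx|Nx] := pselect (N x); [right|left; rewrite -ab].
by split; apply: H => [|x Nx]; rewrite ?fg//; [exact: mr|exact: mi].
Qed.

Lemma cintegral_off_null f g : off_null f g -> cintegral f = cintegral g.
Proof.
move=> [N [mN N0 fg]]; rewrite /cintegral /Rintegral.
congr (fine _ +i* fine _); apply: (@integral_off_null _ _ _ (leb3 R) N) => // x Nx;
  by rewrite fg.
Qed.

Lemma off_nullMr f g u : off_null f g ->
  off_null (fun x => f x * u x) (fun x => g x * u x).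
Proof. by move=> [N [mN N0 fg]]; exists N; split => // x Nx; rewrite fg. Qed.

Lemma cintegral_linear (c : R[i]) f g : cintegrable f -> cintegrable g ->
  cintegral (fun x => c * f x + g x) = c * cintegral f + cintegral g.
Proof.
move=> [fr fi] [gr gi]; case: c => a b.
have Z (r : R) (h : R3 R -> R) : (leb3 R).-integrable setT (EFin \o h) ->
    (leb3 R).-integrable setT (EFin \o (fun x => r * h x)).
  by move=> /(integrableZl measurableT r).
have D (h1 h2 : R3 R -> R) : (leb3 R).-integrable setT (EFin \o h1) ->
    (leb3 R).-integrable setT (EFin \o h2) ->
    (leb3 R).-integrable setT (EFin \o (fun x => h1 x + h2 x)).
  by move=> j1 j2; have := integrableD measurableT j1 j2.
apply: complex_ext.
- rewrite ReD ReM /= -!RintegralZl// -RintegralB//; [|exact: Z|exact: Z].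
  rewrite -RintegralD//; last first.
    by have := integrableB measurableT (Z a _ fr) (Z b _ fi); congr (_.-integrable _ _).
  by apply: eq_Rintegral => x _; rewrite ReD ReM.
- rewrite ImD ImM /= -!RintegralZl// -RintegralD//; [|exact: Z|exact: Z].
  rewrite -RintegralD//; last by apply: D; exact: Z.
  by apply: eq_Rintegral => x _; rewrite ImD ImM.
Qed.

Lemma normc_cintegral_le f (b : R3 R -> R) : cmeasurable f ->
  (leb3 R).-integrable setT (EFin \o b) ->
  (forall x, `|Re (f x)| <= b x) -> (forall x, `|Im (f x)| <= b x) ->
  normc (cintegral f) <= 2 * \int[leb3 R]_x b x.
Proof.
move=> [mr mi] jb fr fi; apply: le_trans (normc_le_absD _) _.
have H (h : R3 R -> R) : measurable_fun setT h -> (forall x, `|h x| <= b x) ->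
    `|\int[leb3 R]_x h x| <= \int[leb3 R]_x b x.
  move=> mh hb; have jh := @integrable_bounded _ _ R (leb3 R) h b mh hb jb.
  apply: le_trans (le_normr_Rintegral _ jh) _ => //.
  apply: le_Rintegral => //; first exact: (integrable_abse jh).
by rewrite mulr_natl mulr2n lerD// H.
Qed.

End LebesgueMeasurable.

(** * Tempered functionals *)

Section TemperedFunctionals.
Context {R : realType}.
Implicit Types (f g u v phi psi : R3 R -> R[i]).

(** A weight containing [H] is only Lebesgue measurable, whereas [cintegrable] includes Borel
    measurability; it is therefore asked of a representative. *)
Definition almost_integrable g := exists2 g', off_null g g' & cintegrable g'.

Lemma cintegrableM_bounded f u (B : R) : cintegrable f -> cmeasurable u ->
  (forall x, normc (u x) <= B) -> cintegrable (fun x => f x * u x).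
Proof.
move=> [fr fi] [mr mi] uB.
have br x : `|Re (u x)| <= B by exact: le_trans (normc_ge_absRe _) (uB x).
have bi x : `|Im (u x)| <= B by exact: le_trans (normc_ge_absIm _) (uB x).
have M (h w : R3 R -> R) : (leb3 R).-integrable setT (EFin \o h) ->
    measurable_fun setT w -> (forall x, `|w x| <= B) ->
    (leb3 R).-integrable setT (EFin \o (h \* w)).
  by move=> jh mw wB; exact: (@integrableM_bounded _ _ R (leb3 R) h w B mw wB jh).
split.
- have := integrableB measurableT (M _ _ fr mr br) (M _ _ fi mi bi).
  by congr (_.-integrable _ _); apply/funext => x /=; rewrite ReM.
- have := integrableD measurableT (M _ _ fr mi bi) (M _ _ fi mr br).
  by congr (_.-integrable _ _); apply/funext => x /=; rewrite ImM.
Qed.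

Lemma cintegral_weight_linear g u v (c : R[i]) (B1 B2 : R) : almost_integrable g ->
  cmeasurable u -> (forall x, normc (u x) <= B1) ->
  cmeasurable v -> (forall x, normc (v x) <= B2) ->
  cintegral (fun x => g x * (c * u x + v x)) =
  c * cintegral (fun x => g x * u x) + cintegral (fun x => g x * v x).
Proof.
move=> [g' gg' jg'] mu bu mv bv.
rewrite !(cintegral_off_null (off_nullMr _ gg')).
rewrite -cintegral_linear; last 2 first.
- exact: cintegrableM_bounded bu.
- exact: cintegrableM_bounded bv.
by congr cintegral; apply/funext => x; rewrite mulrDr mulrCA.
Qed.

Lemma cintegral_weight_bound g : almost_integrable g ->
  exists2 A : R, 0 <= A & forall u (B : R), cmeasurable u ->
    (forall x, normc (u x) <= B) -> normc (cintegral (fun x => g x * u x)) <= A * B.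
Proof.
move=> [g' gg' jg'].
pose b x : R := `|Re (g' x)| + `|Im (g' x)|.
have [jr ji] := jg'.
have jb : (leb3 R).-integrable setT (EFin \o b).
  by have := integrableD measurableT (integrable_abse jr) (integrable_abse ji);
    congr (_.-integrable _ _).
exists (2 * \int[leb3 R]_x b x).
  by rewrite mulr_ge0//; apply: Rintegral_ge0 => x _; exact: addr_ge0.
move=> u B mu bu; rewrite (cintegral_off_null (off_nullMr _ gg')).
rewrite -mulrA -RintegralZr//.
have [/(measurable_int _) m1 /(measurable_int _) m2] := cintegrableM_bounded jg' mu bu.
have le x : normc (g' x * u x) <= b x * B.
  rewrite normcM ler_pM ?normc_ge0 ?normc_le_absD//.
apply: normc_cintegral_le.
- by split; apply/measurable_EFinP.
- by have := integrableZr measurableT B jb; congr (_.-integrable _ _).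
- by move=> x; exact: le_trans (normc_ge_absRe _) (le x).
- by move=> x; exact: le_trans (normc_ge_absIm _) (le x).
Qed.

Lemma crapid_linear (c : R[i]) phi psi : crapid phi -> crapid psi ->
  crapid (fun x => c * phi x + psi x).
Proof.
move=> [pr pi] [qr qi]; split.
- have := rapidD (rapidD (rapidZ (Re c) pr) (rapidZ (- Im c) pi)) qr.
  by congr rapid; apply/funext => x; rewrite ReD ReM mulNr.
- have := rapidD (rapidD (rapidZ (Re c) pi) (rapidZ (Im c) pr)) qi.
  by congr rapid; apply/funext => x; rewrite ImD ImM.
Qed.

Lemma crapid_bounded phi : crapid phi ->
  exists B : R, forall x, normc (phi x) <= B.
Proof.
move=> [/rapid_bound[M1 h1] /rapid_bound[M2 h2]]; exists (M1 + M2) => x.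
by rewrite (le_trans (normc_le_absD _))// lerD.
Qed.

(** Used with [L] the identity and with [L] the inverse Fourier transform. By linearity, continuity
    at [phi0] reduces to a bound of the functional on [phi - phi0]. *)
Lemma tempered_cintegral_weight g (L : (R3 R -> R[i]) -> R3 R -> R[i]) :
  almost_integrable g ->
  (forall phi, crapid phi -> cmeasurable (L phi)) ->
  (forall phi, crapid phi -> exists B : R, forall x, normc (L phi x) <= B) ->
  (forall c phi psi, crapid phi -> crapid psi ->
     L (fun x => c * phi x + psi x) = fun x => c * L phi x + L psi x) ->
  (exists N, exists2 K : R, 0 <= K & forall phi d, crapid phi -> 0 <= d ->
     schwartz_ball N d phi -> forall x, normc (L phi x) <= K * d) ->
  tempered (fun phi => cintegral (fun x => g x * L phi x)).
Proof.
move=> jg mL bL lL [N [K K0 LK]].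
have lin c phi psi : crapid phi -> crapid psi ->
    cintegral (fun x => g x * L (fun y => (c * phi y + psi y)%R) x) =
    c * cintegral (fun x => g x * L phi x) + cintegral (fun x => g x * L psi x).
  move=> rp rq; rewrite lL//.
  have [B1 b1] := bL _ rp; have [B2 b2] := bL _ rq.
  exact: (cintegral_weight_linear _ jg (mL _ rp) b1 (mL _ rq) b2).
split.
  move=> c phi psi sp sq; apply: lin; exact: (schwartz_crapid [::]).
move=> phi0 /(schwartz_crapid [::]) r0 eps eps0.
have [A A0 hA] := cintegral_weight_bound jg.
have AK : 0 < A * K + 1 by rewrite ltr_wpDl// mulr_ge0.
(* The [+ 1] guards against [A * K = 0]; the half yields a strict inequality. *)
exists N, (eps / 2 / (A * K + 1)); first by rewrite !divr_gt0.
move=> phi /(schwartz_crapid [::]) r1 ball.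
rewrite addrC -mulN1r -lin//.
have E : (fun y => -1 * phi0 y + phi y) = (fun y => phi y - phi0 y).
  by apply/funext => y; rewrite mulN1r addrC.
have rB : crapid (fun y => phi y - phi0 y).
  by rewrite -E; exact: crapid_linear.
rewrite E; set d := eps / 2 / (A * K + 1) in ball.
have d0 : 0 <= d by rewrite ltW// !divr_gt0.
apply: (@le_lt_trans _ _ (A * (K * d))).
  by apply: hA; [exact: mL|exact: LK].
rewrite mulrA (@le_lt_trans _ _ (eps / 2))//;
  last by rewrite ltr_pdivrMr// ltr_pMr// ltr1n.
by rewrite /d mulrCA ler_piMr ?divr_ge0 ?ltW// ltr_pdivrMr// mul1r ltrDl.
Qed.

Lemma tempered_scale (c : R) (T : functional R) : tempered T -> tempered (dist_scale c T).
Proof.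
move=> [lT cT]; split.
  by move=> a phi psi sp sq; rewrite /dist_scale lT// mulrDr mulrCA.
move=> phi0 s0 eps eps0.
have c1 : 0 < `|c| + 1 by rewrite ltr_wpDl.
have [|N [d d0 H]] := cT phi0 s0 (eps / (`|c| + 1)); first by rewrite divr_gt0.
exists N, d => // phi sp ball.
rewrite /dist_scale -mulrBr normcM normcR.
have := H _ sp ball; rewrite ltr_pdivlMr// => h; apply: le_lt_trans h.
by rewrite mulrC ler_wpM2l ?normc_ge0// lerDl.
Qed.

Lemma schwartz_ball0 (d : R) phi : schwartz_ball 0 d phi -> forall x, normc (phi x) <= d.
Proof.
move=> /(_ (fun=> 0%N) [::]) H x; have := H _ erefl x.
by rewrite monomial0 mul1r; apply; rewrite big1.
Qed.

(** Order 6 admits every monomial with exponent at most 2 in each of the three coordinates, as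
    [decay_bound] demands. *)
Lemma schwartz_ball_decay (d : R) phi : schwartz_ball 6 d phi ->
  forall x, `|Re (phi x)| <= 8 * d * decay x /\ `|Im (phi x)| <= 8 * d * decay x.
Proof.
move=> H x; have le a : (forall i, (a i <= 2)%N) -> normc ((monomial a x)%:C * phi x)
  <= d.
  move=> ha; apply: (H a [::]) => //.
  by apply: (@leq_trans (\sum_(i < 3) 2)%N);
    [exact: leq_sum|rewrite sum_nat_const card_ord].
split; apply: decay_bound => a ha.
- by rewrite -ReRM (le_trans (normc_ge_absRe _))// le.
- by rewrite -ImRM (le_trans (normc_ge_absIm _))// le.
Qed.

Lemma tempered_dist_of_fun g : almost_integrable g -> tempered (dist_of_fun g).
Proof.
move=> jg; apply: (@tempered_cintegral_weight g id jg) => //.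
- by move=> phi [[mr _] [mi _]].
- exact: crapid_bounded.
- by exists 0%N, 1 => // phi d _ _ /schwartz_ball0 H x; rewrite mul1r.
Qed.

Lemma cmeasurable_inv_fourier phi : crapid phi -> cmeasurable (inv_fourier phi).
Proof.
move=> rp; have m h c (rh : rapid h) : measurable_fun setT (trig_transform h c : R3 R
  -> R).
  by apply: continuous_measurable3; exact: continuous_trig_transform.
split.
- rewrite (funext (fun k => Re_inv_fourier k rp)).
  by apply: measurable_funM => //; apply: measurable_funB; apply: m;
    [exact: rp.1|exact: rp.2].
- rewrite (funext (fun k => Im_inv_fourier k rp)).
  by apply: measurable_funM => //; apply: measurable_funD; apply: m;
    [exact: rp.1|exact: rp.2].
Qed.

Lemma cintegrable_fourier_kernel phi k : crapid phi ->
  cintegrable (fun x => phi x * cexpi (dot x k)).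
Proof.
move=> [rr ri].
have r1 h (rh : rapid h) := rapid_cos k 0 rh.
have r2 h (rh : rapid h) := rapid_cos k (- (pi / 2)) rh.
split.
- have := rapid_integrable (rapidD (r1 _ rr) (rapidN (r2 _ ri))).
  by congr (_.-integrable _ _); apply/funext => x;
    rewrite /= ReM /= (dotC x) addr0 cos_shift.
- have := rapid_integrable (rapidD (r2 _ rr) (r1 _ ri)).
  by congr (_.-integrable _ _); apply/funext => x;
    rewrite /= ImM /= (dotC x) addr0 cos_shift.
Qed.

Lemma inv_fourier_linear (c : R[i]) phi psi : crapid phi -> crapid psi ->
  inv_fourier (fun x => c * phi x + psi x) =
  fun k => c * inv_fourier phi k + inv_fourier psi k.
Proof.
move=> rp rq; apply/funext => k; rewrite /inv_fourier.
rewrite [X in _ = X + _]mulrCA -mulrDr.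
rewrite -(cintegral_linear c (cintegrable_fourier_kernel k rp)
  (cintegrable_fourier_kernel k rq)).
by congr (_ * cintegral _); apply/funext => x; rewrite mulrDl mulrA.
Qed.

(** The constant 4 is crude: each part of [phi x * cexpi (dot x k)] is at most [2 * b x], and
    passing from the two parts of the integral to its modulus doubles again. *)
Lemma normc_inv_fourier_le phi (b : R3 R -> R) k : crapid phi ->
  (leb3 R).-integrable setT (EFin \o b) ->
  (forall x, `|Re (phi x)| <= b x) -> (forall x, `|Im (phi x)| <= b x) ->
  normc (inv_fourier phi k) <= `|((2 * pi) ^+ 3)^-1| * (4 * \int[leb3 R]_x b x).
Proof.
move=> rp jb br bi; rewrite /inv_fourier normcM normcR ler_wpM2l//.
have -> : 4 * \int[leb3 R]_x b x = 2 * \int[leb3 R]_x (2 * b x).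
  by rewrite RintegralZl// mulrA -natrM.
have [/(measurable_int _) m1 /(measurable_int _) m2] := cintegrable_fourier_kernel k rp.
have n t : `|sin t| <= 1 :> R by rewrite ler_norml sin_geN1 sin_le1.
apply: normc_cintegral_le.
- by split; apply/measurable_EFinP.
- by have := integrableZl measurableT 2 jb; congr (_.-integrable _ _).
- move=> x; rewrite ReM /= mulr_natl mulr2n (le_trans (ler_normB _ _))// lerD// normrM.
    by rewrite (le_trans _ (br x))// ler_piMr// norm_cos_le1.
  by rewrite (le_trans _ (bi x))// ler_piMr.
- move=> x; rewrite ImM /= mulr_natl mulr2n (le_trans (ler_normD _ _))// lerD// normrM.
    by rewrite (le_trans _ (br x))// ler_piMr.
  by rewrite (le_trans _ (bi x))// ler_piMr// norm_cos_le1.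
Qed.

Lemma inv_fourier_bounded phi : crapid phi ->
  exists B : R, forall k, normc (inv_fourier phi k) <= B.
Proof.
move=> rp; have jb := integrableD measurableT
  (integrable_abse (rapid_integrable rp.1)) (integrable_abse (rapid_integrable rp.2)).
exists (`|((2 * pi) ^+ 3)^-1| * (4 * \int[leb3 R]_x (`|Re (phi x)| + `|Im (phi x)|)))
  => k.
by apply: normc_inv_fourier_le => // x; rewrite ?lerDl ?lerDr.
Qed.

Lemma tempered_dist_inv_fourier g : almost_integrable g ->
  tempered (dist_inv_fourier (dist_of_fun g)).
Proof.
move=> jg; apply: (@tempered_cintegral_weight g (@inv_fourier R) jg).
- exact: cmeasurable_inv_fourier.
- exact: inv_fourier_bounded.
- exact: inv_fourier_linear.
- have D0 : 0 <= \int[leb3 R]_x decay x.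
    by apply: Rintegral_ge0 => x _; rewrite ltW// decay_gt0.
  (* The bound of [normc_inv_fourier_le] with [b = 8 * d * decay], divided by [d]. *)
  exists 6%N, (`|((2 * pi) ^+ 3)^-1| * (4 * (8 * \int[leb3 R]_x decay x))).
    by rewrite !mulr_ge0.
  move=> phi d rp d0 /schwartz_ball_decay H k.
  set c3 := `|_|; rewrite (_ : _ * d = c3 * (4 * (8 * d * \int[leb3 R]_x decay x)));
    last by ring.
  rewrite -RintegralZl//; last exact: integrable_decay.
  apply: normc_inv_fourier_le => //.
  + by have := integrableZl measurableT (8 * d) (@integrable_decay R);
    congr (_.-integrable _ _).
  + by move=> x; have [] := H x.
  + by move=> x; have [] := H x.
Qed.

End TemperedFunctionals.

(** * The weight as a tempered function, and the field equation *)

Section StaticField.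
Context {R : realType}.
Implicit Types (f g H : R3 R -> R[i]).

Lemma compact_measurable3 (K : set (R3 R)) : compact K -> measurable K.
Proof.
move=> cK; rewrite -[K]setCK; apply: measurableC; apply: open_measurable3.
by apply: closed_openC; apply: compact_closed => //; exact: norm_hausdorff.
Qed.

Lemma cintegrable_normc f : cintegrable f ->
  (leb3 R).-integrable setT (fun x => (normc (f x))%:E).
Proof.
move=> [jr ji].
have mr : measurable_fun setT (fun x => Re (f x)) by have
  /measurable_int/measurable_EFinP := jr.
have mi : measurable_fun setT (fun x => Im (f x)) by have
  /measurable_int/measurable_EFinP := ji.
apply: (@integrable_bounded _ _ R (leb3 R) (fun x => normc (f x))
  (fun x => `|Re (f x)| + `|Im (f x)|)).
- rewrite (_ : (fun x => _) = (fun x => Num.sqrt (Re (f x) ^+ 2 + Im (f x) ^+ 2)));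
  last first.
    by apply/funext => x; case: (f x).
  apply: (measurableT_comp (f := fun r : R => Num.sqrt r)).
    by apply: continuous_measurable_fun; exact: sqrt_continuous.
  by apply: measurable_funD; exact: measurable_funX.
- by move=> x; rewrite ger0_norm ?normc_ge0 ?normc_le_absD.
- have := integrableD measurableT (integrable_abse jr) (integrable_abse ji).
  by congr (_.-integrable _ _).
Qed.

Lemma almost_integrable_tempered_function g : almost_integrable g -> tempered_function g.
Proof.
move=> [g' gg' jg']; have jn := cintegrable_normc jg'.
have [N [mN N0 eq_g]] := gg'.
have E D : (\int[leb3 R]_(x in D) (normc (g x))%:E =
    \int[leb3 R]_(x in D) `|(normc (g' x))%:E|)%E.
  rewrite integral_mkcond [RHS]integral_mkcond.
  apply: (@integral_off_null _ _ _ (leb3 R) N) => // x Nx; rewrite !patchE.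
  by case: (x \in D) => //; rewrite eq_g// gee0_abs// lee_fin normc_ge0.
split; last first.
  (* The weight is integrable over all of R^3, so the exponent [s = 0] suffices. *)
  exists 0 => //; have /integrableP[_] := jn; rewrite -E.
  have -> // : (fun x => (normc (g x))%:E) =
      (fun x => (normc (g x) * (1 + sqnorm x) `^ (- (0 / 2)))%:E).
  by apply/funext => x; rewrite mul0r oppr0 powRr0 mulr1.
split.
  apply: off_null_lebesgue_measurable gg'.
  by split; [have /measurable_int/measurable_EFinP := jg'.1|have
    /measurable_int/measurable_EFinP := jg'.2].
move=> K /compact_measurable3 mK; rewrite E.
by have /integrableP[_] := @integrableS _ _ R (leb3 R) setT K _ measurableT mK
  (@subsetT _ K) jn.
Qed.

Lemma bounded_lebesgue_borel H (M : R) : lebesgue_measurable H ->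
  (forall k, normc (H k) <= M) ->
  exists H', [/\ off_null H H', cmeasurable H' & forall k, normc (H' k) <= M].
Proof.
move=> /lebesgue_measurable_borel[N [mN N0 mH]] HM.
exists (fun x => (\1_(~` N) x)%:C * H x); split => //.
  by exists N; split => // x Nx; rewrite indicE mem_set// mul1r.
move=> k; rewrite normcM normcR; apply: le_trans (HM k).
rewrite ler_piMl ?normc_ge0// ger0_norm//.
Qed.

Lemma cmeasurableZ (c : R[i]) f : cmeasurable f -> cmeasurable (fun x => c * f x).
Proof.
move=> [mr mi]; split.
- rewrite (_ : (fun x => _) = (fun x => Re c * Re (f x) - Im c * Im (f x))).
    by apply: measurable_funB; exact: measurable_funM.
  by apply/funext => x; rewrite ReM.
- rewrite (_ : (fun x => _) = (fun x => Re c * Im (f x) + Im c * Re (f x))).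
    by apply: measurable_funD; exact: measurable_funM.
  by apply/funext => x; rewrite ImM.
Qed.

(** Serves twice: with the singular weight for [g], and with the pure Gaussian left after the
    Laplacian has cancelled [|k|^2]. *)
Lemma almost_integrable_weight (w : R3 R -> R) (c : R[i]) H (M : R) :
  (leb3 R).-integrable setT (EFin \o w) -> lebesgue_measurable H ->
  (forall k, normc (H k) <= M) ->
  almost_integrable (fun k => (w k)%:C * (c * H k)).
Proof.
move=> jw mH HM; have [H' [[N [mN N0 HH']] mH' H'M]] := bounded_lebesgue_borel mH HM.
exists (fun k => (w k)%:C * (c * H' k)).
  by exists N; split => // k Nk; rewrite HH'.
apply: (@cintegrableM_bounded _ _ _ (normc c * M)).
- by split => //=; exact: integrable0.
- exact: cmeasurableZ.
- by move=> k; rewrite normcM ler_wpM2l ?normc_ge0.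
Qed.

Lemma leb3_set1 (x : R3 R) : leb3 R [set x] = 0%E.
Proof.
rewrite (_ : [set x] = [set x.1] `*` [set x.2]); last first.
  by apply/seteqP; split => [y -> //|[y1 y2] [/= -> ->]]; case: x.
have m1 : measurable [set x.1].
  rewrite (_ : [set x.1] = [set x.1.1] `*` [set x.1.2]).
    by apply: measurableX; exact: measurable_set1.
  by apply/seteqP; split => [y -> //|[y1 y2] [/= -> ->]]; case: x.1.
have m2 : measurable [set x.2] by exact: measurable_set1.
transitivity (@leb2 R [set x.1] * @lebesgue_measure R [set x.2])%E.
  exact: (@product_measure1E _ _ _ _ R (@leb2 R) (@lebesgue_measure R) _ _ m1 m2).
by rewrite lebesgue_measure_set1 mule0.
Qed.

Lemma sqnorm_eq0 (k : R3 R) : sqnorm k = 0 -> k = 0.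
Proof.
rewrite sqnormE => /eqP; rewrite paddr_eq0 ?addr_ge0 ?sqr_ge0// paddr_eq0 ?sqr_ge0//.
by rewrite !sqrf_eq0 => /andP[/andP[/eqP a /eqP b] /eqP c];
  case: k a b c => -[k1 k2] k3 /= -> -> ->.
Qed.

End StaticField.

Theorem proposition5p1 (R : realType) (l kappa : R) (H : R3 R -> R[i])
    (C : 'I_4 -> 'I_4 -> R[i]) (T : 'I_4 -> 'I_4 -> functional R)
    (l_gt0 : 0 < l) (kappa_gt0 : 0 < kappa)
    (H_measurable : lebesgue_measurable H)
    (H_bounded : exists M : R, forall k, normc (H k) <= M)
    (T_tempered : forall mu nu, tempered (T mu nu))
    (T_fourier : forall mu nu,
      dist_eq (dist_fourier (T mu nu)) (dist_of_fun (fun k => C mu nu * H k))) :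
  forall mu nu : 'I_4,
    let g : R3 R -> R[i] := fun k =>
      (expR (- (l ^+ 2 * sqnorm k)) / sqnorm k)%:C * (C mu nu * H k) in
    let Phi : functional R :=
      dist_scale (2 * kappa) (dist_inv_fourier (dist_of_fun g)) in
    [/\ tempered_function g,
        tempered (dist_of_fun g),
        tempered Phi &
        dist_eq (dist_laplacian Phi)
          (dist_scale (- (2 * kappa)) (dist_conv (gaussian l) (T mu nu)))].
Proof.
move=> mu nu g Phi; have [M HM] := H_bounded.
have s0 : 0 < l ^+ 2 by rewrite exprn_gt0.
have jg : almost_integrable g.
  exact: (almost_integrable_weight _ (integrable_gauss_sqnormV s0) H_measurable HM).
split.
- exact: almost_integrable_tempered_function.
- exact: tempered_dist_of_fun.
- exact/tempered_scale/tempered_dist_inv_fourier.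
move=> phi sphi; have rphi : crapid phi := schwartz_crapid [::] sphi.
pose psi k := (gauss (l ^+ 2) k)%:C * inv_fourier phi k.
have spsi : schwartz psi by exact: schwartz_gauss_inv_fourier.
rewrite /dist_scale /dist_conv -(fourier_gauss_conv l_gt0 rphi).
(* [dist_eq] compares functionals only on Schwartz functions; [spsi] allows the test function
   [psi]. *)
rewrite -[T mu nu _]/(dist_fourier (T mu nu) psi) T_fourier//.
rewrite /dist_laplacian /Phi /dist_scale /dist_inv_fourier /dist_of_fun.
pose h k := (gauss (l ^+ 2) k)%:C * (C mu nu * H k).
have jh : almost_integrable h.
  exact: (almost_integrable_weight _ (rapid_integrable (rapid_gauss s0)) H_measurable HM).
have [B hB] := inv_fourier_bounded rphi.
have minv := cmeasurable_inv_fourier rphi.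
have E : cintegral (fun k => g k * inv_fourier (laplacian phi) k) =
    - cintegral (fun k => C mu nu * H k * psi k).
  rewrite (_ : (fun k => C mu nu * H k * psi k) = (fun k =>
    h k * inv_fourier phi k)); last first.
    by apply/funext => k; rewrite /h /psi mulrA [in RHS](mulrC (_%:C)).
  (* Linearity is stated for [c * u + v]; taking [u = v] and [c = - 2] makes it produce a
     negation. *)
  have := cintegral_weight_linear (- 2) jh minv hB minv hB.
  rewrite (_ : - 2 * cintegral _ + _ = - cintegral (fun k =>
    h k * inv_fourier phi k)); last by ring.
  (* At the origin [g] is [0] by the convention for division, while the other integrand may be
     nonzero there, so the integrands are compared off this null set. *)
  move=> <-; apply: cintegral_off_null; exists [set 0]; split.
  - by apply: compact_measurable3; exact: compact_set1.
  - exact: leb3_set1.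
  move=> k k0; have qn0 : sqnorm k != 0 by apply/eqP => /sqnorm_eq0.
  rewrite inv_fourier_laplacian// /g /h.
  have -> : gauss (l ^+ 2) k = expR (- (l ^+ 2 * sqnorm k)) / sqnorm k * sqnorm k.
    by rewrite divfK.
  by rewrite !rmorphM rmorphN /=; ring.
by rewrite E rmorphN mulNr mulrN.
Qed.
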